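(* Let $P$ be a torsion-free abelian group (written multiplicatively), let $A=\mathbb{Z}P$ be its group algebra, and let $a_1^{\pm}, a_2^{\pm}, a_3^{\pm}\in P$ be such that, for every positive integer $n$, $\prod_{i=1}^3 (a_i^+)^n \neq \prod_{i=1}^3 (a_i^-)^n$. Then the upper cluster algebra of the seed with cluster $(x_1,x_2,x_3)$, coefficients $p_i^{\pm}=a_i^{\pm}$ and exchange matrix \[ B=\begin{pmatrix} 0 & 3 & -3 \\ -3 & 0 & 3 \\ 3 & -3 & 0 \end{pmatrix} \] is not finitely generated as a $\mathbb{Z}P$-algebra. In particular, upper cluster algebras need not be finitely generated.
   Context: Let $\mathcal{F}=\mathrm{Frac}(\mathbb{Z}P)(x_1,x_2,x_3)$. A seed (of rank 3) is a triple $(\mathbf{x},\mathbf{p},B)$ where $\mathbf{x}=(x_1,x_2,x_3)$ is a triple of elements freely generating $\mathcal{F}$ as a field over $\mathrm{Frac}(\mathbb{Z}P)$ (the cluster), $\mathbf{p}=(p_1^{\pm},p_2^{\pm},p_3^{\pm})$ is a tuple of elements of $P$ (the coefficients), and $B=(b_{ij})$ is a $3\times 3$ skew-symmetric integer matrix (the exchange matrix). A mutation in direction $k\in\{1,2,3\}$ replaces it by a seed $(\mathbf{x}',\mathbf{p}',B')$ where: (1) $x'_j=x_j$ for $j\ne k$, and $x_k x_k' = p_k^+\prod_{b_{ki}>0} x_i^{b_{ki}} + p_k^-\prod_{b_{ki}<0} x_i^{-b_{ki}}$; (2) $b'_{ij}=-b_{ij}$ if $i=k$ or $j=k$, and $b'_{ij}=b_{ij}+\tfrac12(|b_{ik}|b_{kj}+b_{ik}|b_{kj}|)$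 otherwise; (3) $(p_k')^{\pm}=p_k^{\mp}$, and for $j\neq k$ the ratio $(p_j')^+/(p_j')^-$ equals $(p_k^+)^{b_{jk}}\,p_j^+/p_j^-$ if $b_{jk}\ge 0$ and $(p_k^-)^{b_{jk}}\,p_j^+/p_j^-$ if $b_{jk}\le 0$. (The coefficients $(p_j')^{\pm}$, $j\neq k$, are thus determined only up to a common factor in $P$; different choices change later cluster variables only by factors in $P$ and do not affect the Laurent polynomial rings below.) Two seeds are mutation equivalent if one is obtained from the other by a finite sequence of mutations. The upper cluster algebra of a seed is the intersection, inside $\mathcal{F}$, of the Laurent polynomial rings $\mathbb{Z}P[y_1^{\pm},y_2^{\pm},y_3^{\pm}]$ over all clusters $(y_1,y_2,y_3)$ of seeds mutation equivalent to it. *)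

(* Defs.v *)
(* Classical reasoning is used only to make the group ring of a torsion-free
   abelian group an integral domain: Zorn's lemma orders the group, and excluded
   middle decides invertibility. *)
From HB Require Import structures.
From mathcomp Require Import all_boot all_order all_algebra.
From mathcomp Require finmap monalg mpoly boolp classical_sets.
From Stdlib Require Import Relation_Operators.

Set Implicit Arguments.
Unset Strict Implicit.
Unset Printing Implicit Defensive.

Import Order.TTheory GRing.Theory Num.Theory.
Local Open Scope ring_scope.

(* The coefficient group is written additively: p * q, p ^ n and 1 in the
   multiplicative notation are p + q, p *+ n (or p *~ n for n : int) and 0. *)
HB.mixin Record Zmodule_isTorsionFree P of GRing.Zmodule P := {
  torsion_free : forall (p : P) (n : nat), (0 < n)%N -> p *+ n = 0 -> p = 0
}.

#[short(type="torsionFreeZmodType")]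
HB.structure Definition TorsionFreeZmodule :=
  { P of GRing.Zmodule P & Zmodule_isTorsionFree P }.

(* The group ring R[P]: finitely supported functions P -> R with convolution.
   The library's ring structure on malg does not apply, because it requires a
   monoid without nontrivial invertible elements. *)
Definition group_ring (R : idomainType) (P : torsionFreeZmodType) : Type :=
  monalg.malg P R.

Module GroupRing.
Import finmap monalg boolp classical_sets.
Local Open Scope fset_scope.
Local Open Scope ring_scope.

Section Ring.
Variables (R : idomainType) (P : torsionFreeZmodType).
Local Notation ZP := {malg R[P]}.
Implicit Types (g : ZP) (k : P).

Definition one : ZP := << 0 >>.

Definition mul g1 g2 : ZP :=
  \sum_(k1 <- msupp g1) \sum_(k2 <- msupp g2) << g1@_k1 * g2@_k2 *g k1 + k2 >>.

Lemma mulw (d1 d2 : {fset P}) g1 g2 :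
  msupp g1 `<=` d1 -> msupp g2 `<=` d2 ->
  mul g1 g2 = \sum_(k1 <- d1) \sum_(k2 <- d2) << g1@_k1 * g2@_k2 *g k1 + k2 >>.
Proof.
move=> le_d1 le_d2; rewrite /mul (big_fset_incl _ le_d1) /=.
  apply/eq_bigr=> k1 _; apply/big_fset_incl => // k _ /mcoeff_outdom ->.
  by rewrite mulr0 monalgU0.
move=> k _ /mcoeff_outdom g1k.
by rewrite big1 => // k' _; rewrite g1k mul0r monalgU0.
Qed.

Lemma mulC : commutative mul.
Proof.
move=> g1 g2; rewrite /mul exchange_big /=; apply/eq_bigr => k2 _.
by apply/eq_bigr => k1 _; rewrite mulrC addrC.
Qed.

Lemma mulDl : left_distributive mul +%R.
Proof.
move=> g1 g2 g; rewrite (mulw (msuppD_le g1 g2) (fsubset_refl _)).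
rewrite (mulw (fsubsetUl _ (msupp g2)) (fsubset_refl (msupp g))).
rewrite (mulw (fsubsetUr (msupp g1) _) (fsubset_refl (msupp g))).
rewrite -big_split /=; apply/eq_bigr=> k1 _.
rewrite -big_split /=; apply/eq_bigr=> k2 _.
by rewrite mcoeffD mulrDl monalgUD.
Qed.

Lemma mulDr : right_distributive mul +%R.
Proof. by move=> g g1 g2; rewrite mulC mulDl !(mulC _ g). Qed.

Lemma mul0g : left_zero 0 mul.
Proof. by move=> g; rewrite /mul msupp0 big_seq_fset0. Qed.

Lemma mulg0 : right_zero 0 mul.
Proof. by move=> g; rewrite mulC mul0g. Qed.

Lemma mulUU c1 c2 k1 k2 :
  mul << c1 *g k1 >> << c2 *g k2 >> = << c1 * c2 *g k1 + k2 >>.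
Proof. by rewrite (mulw msuppU_le msuppU_le) !big_seq_fset1 !mcoeffUU. Qed.

Lemma mul_suml I (r : seq I) (F : I -> ZP) g :
  mul (\sum_(i <- r) F i) g = \sum_(i <- r) mul (F i) g.
Proof. exact: (big_morph (mul^~ g) (fun _ _ => mulDl _ _ _) (mul0g _)). Qed.

Lemma mul_sumr I (r : seq I) (F : I -> ZP) g :
  mul g (\sum_(i <- r) F i) = \sum_(i <- r) mul g (F i).
Proof. exact: (big_morph (mul g) (fun _ _ => mulDr _ _ _) (mulg0 _)). Qed.

Lemma gE g : g = \sum_(k <- msupp g) << g@_k *g k >>.
Proof. exact: monalgE. Qed.

Lemma mulA : associative mul.
Proof.
move=> g1 g2 g3; rewrite [g1]gE [g2]gE [g3]gE.
rewrite !mul_suml; apply/eq_bigr => k1 _.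
rewrite mul_sumr (mul_sumr (msupp g2)) mul_suml; apply/eq_bigr => k2 _.
rewrite !mul_sumr; apply/eq_bigr => k3 _.
by rewrite !mulUU mulrA addrA.
Qed.

Lemma mul1g : left_id one mul.
Proof.
move=> g; rewrite [g]gE mul_sumr; apply/eq_bigr => k _.
by rewrite mulUU mul1r add0r.
Qed.

Lemma one_neq0 : one != 0.
Proof. by apply/eqP/malgP=> /(_ 0) /eqP; rewrite !mcoeffsE oner_eq0. Qed.

Lemma mcoeff_mul g1 g2 k :
  (mul g1 g2)@_k = \sum_(k1 <- msupp g1) \sum_(k2 <- msupp g2)
    (g1@_k1 * g2@_k2) *+ (k1 + k2 == k).
Proof.
rewrite raddf_sum /=; apply/eq_bigr=> k1 _; rewrite raddf_sum /=.
by apply/eq_bigr=> k2 _; rewrite mcoeffU.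
Qed.

Local Close Scope fset_scope.
Local Open Scope classical_set_scope.

(* A torsion-free abelian group admits a total order compatible with +,
   given here by its cone of nonnegative elements. *)
Definition cone (C : set P) :=
  [/\ C 0, forall x y, C x -> C y -> C (x + y) &
      forall x, C x -> C (- x) -> x = 0].

Lemma total_cone : exists C, cone C /\ forall x, C x \/ C (- x).
Proof.
have [F FC totF|C [coneC maxC]] := @Zorn_bigcup P (fun A => cone (A `|` [set 0])).
  split; first by right.
  - move=> x y [[X FX Xx]|->] [[Y FY Yy]|->]; rewrite ?add0r ?addr0;
      try by [right | left; exists X | left; exists Y].
    have [XY|YX] := totF _ _ FX FY.
    + have [_ /(_ x y) D _] := FC _ FY.
      by case: D => [||?|->]; [left; exact: XY|left| left; exists Y|right].
    + have [_ /(_ x y) D _] := FC _ FX.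
      by case: D => [||?|->]; [left| left; exact: YX|left; exists X|right].
  - move=> x [[X FX Xx]|->] // [[Y FY Yy]|/eqP]; last first.
      by rewrite oppr_eq0 => /eqP.
    have [XY|YX] := totF _ _ FX FY.
    + by have [_ _ D] := FC _ FY; apply: D; left => //; exact: XY.
    + by have [_ _ D] := FC _ FX; apply: D; left => //; exact: YX.
set D := C `|` [set 0] in coneC.
have [D0 DD DN] := coneC.
have Dn x n : D x -> D (x *+ n).
  by move=> Dx; elim: n => [|n IH] //; rewrite mulrS; exact: DD.
exists D; split=> //.
have key x : ~ D x -> exists n, (0 < n)%N /\ D (- x *+ n).
  move=> nDx; apply: contrapT => nE.
  pose E := [set y | exists d n, D d /\ y = d + x *+ n].
  have CE : C `<=` E by move=> y Cy; exists y, 0%N; rewrite addr0; split=> //; left.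
  have Ex : E x by exists 0, 1%N; rewrite add0r.
  apply: (maxC E).
    split=> // EC; apply: nDx; left; exact: EC.
  have -> : E `|` [set 0] = E.
    by apply/seteqP; split=> y; [case=> [//|->]; exists 0, 0%N; rewrite addr0|left].
  split; first by exists 0, 0%N; rewrite addr0.
    move=> _ _ [d [n [Dd ->]]] [e [m [De ->]]]; exists (d + e), (n + m)%N.
    by rewrite mulrnDr addrACA; split=> //; exact: DD.
  move=> _ [d [n [Dd ->]]] [e [m [De eqE]]].
  have sumE : d + e = - x *+ (n + m).
    rewrite mulrnDr !mulNrn; apply/eqP; rewrite -subr_eq0 opprD !opprK.
    by rewrite addrACA -eqE subrr.
  have [nm0|nm_gt0] := posnP (n + m); last first.
    by case: nE; exists (n + m)%N; rewrite -sumE; split=> //; exact: DD.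
  move: nm0 sumE => /eqP; rewrite addn_eq0 => /andP[/eqP -> /eqP ->].
  rewrite !mulr0n addr0 => /eqP; rewrite addr_eq0 => /eqP dE.
  by apply: DN => //; rewrite dE opprK.
move=> x; apply: contrapT => /not_orP[nDx nDNx].
have [n [n0 Dnx]] := key _ nDx.
have [m [m0]] := key _ nDNx; rewrite opprK => Dmx.
have xnm0 : x *+ (n * m) = 0.
  apply: DN; first by rewrite mulnC mulrnA; exact: Dn.
  by rewrite -mulNrn mulrnA; exact: Dn.
have nm_gt0 : (0 < n * m)%N by rewrite muln_gt0 n0.
by apply: nDx; rewrite (torsion_free x _ nm_gt0 xnm0).
Qed.

Lemma mul_eq0 g1 g2 : mul g1 g2 = 0 -> (g1 == 0) || (g2 == 0).
Proof.
have [C [[C0 CD CN] Ctot]] := total_cone.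
have supp_max (s : seq P) : s != [::] ->
    exists2 m, m \in s & forall k, k \in s -> C (m - k).
  elim: s => // k s IH _; have [->|/IH[m ms mmax]] := eqVneq s [::].
    by exists k; rewrite ?mem_head // => l; rewrite inE => /eqP ->; rewrite subrr.
  have [Cmk|Ckm] := Ctot (m - k).
    exists m; first by rewrite inE ms orbT.
    by move=> l; rewrite inE => /predU1P[->|/mmax].
  exists k; first exact: mem_head.
  move=> l; rewrite inE => /predU1P[->|/mmax Cml]; first by rewrite subrr.
  by rewrite -(subrKA m) -(opprB m k); exact: CD.
have nz_supp g : g != 0 -> (msupp g : seq P) != [::].
  apply: contra_neqN => /eqP s0; rewrite [g]gE s0 big_nil //.
move=> g12; apply: contrapT => /negP; rewrite negb_or => /andP[g1nz g2nz].
have [m1 m1s max1] := supp_max _ (nz_supp _ g1nz).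
have [m2 m2s max2] := supp_max _ (nz_supp _ g2nz).
have : (mul g1 g2)@_(m1 + m2) = g1@_m1 * g2@_m2.
  rewrite mcoeff_mul (bigD1_seq m1) ?fset_uniq //=.
  rewrite (bigD1_seq m2) ?fset_uniq //= eqxx mulr1n.
  rewrite big1_seq ?addr0 => [|k2 /andP[k2m _]]; last first.
    by rewrite (inj_eq (addrI m1)) (negbTE k2m) mulr0n.
  rewrite big1_seq ?addr0 // => k1 /andP[k1m k1s].
  rewrite big1_seq // => k2 /= k2s.
  have [eqk|] := eqVneq; last by rewrite mulr0n.
  case/eqP: k1m; apply/eqP; rewrite eq_sym -subr_eq0; apply/eqP.
  apply: CN; first exact: max1.
  have -> : - (m1 - k1) = m2 - k2; last exact: max2.
  rewrite opprB; apply/eqP.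
  by rewrite subr_eq addrAC (addrC m2) -eqk addrK.
rewrite g12 mcoeff0 => /esym/eqP; rewrite mulf_eq0.
by move: m1s m2s; rewrite -!mcoeff_neq0 => /negbTE -> /negbTE ->.
Qed.

Definition unit : pred ZP := fun g => `[< exists h, mul h g = one >].
Definition inv g : ZP :=
  if pselect (exists h, mul h g = one) is left E then sval (cid E) else g.

Lemma mulVg : {in unit, left_inverse one inv mul}.
Proof. by move=> g /asboolP ug; rewrite /inv; case: pselect => // E; case: cid. Qed.

Lemma unitP g h : mul h g = one -> unit g.
Proof. by move=> hg; apply/asboolP; exists h. Qed.

Lemma inv_out : {in [predC unit], inv =1 id}.
Proof.
move=> g /negP nug; rewrite /inv; case: pselect => // E.
by case: nug; apply/asboolP.
Qed.

End Ring.

Section Instances.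
Variables (R : idomainType) (P : torsionFreeZmodType).
Local Notation RP := (group_ring R P).

HB.instance Definition _ := GRing.Zmodule.copy RP {malg R[P]}.
HB.instance Definition _ := GRing.Zmodule_isComNzRing.Build RP
  (@mulA R P) (@mulC R P) (@mul1g R P) (@mulDl R P) (@one_neq0 R P).
HB.instance Definition _ := GRing.ComNzRing_hasMulInverse.Build RP
  (@mulVg R P) (@unitP R P) (@inv_out R P).
HB.instance Definition _ := GRing.ComUnitRing_isIntegral.Build RP
  (@mul_eq0 R P).

(* The group element p, as an element of the group ring. *)
Definition of_group (p : P) : RP := << p >>.

End Instances.
End GroupRing.
HB.export GroupRing.

Import mpoly.
Local Open Scope ring_scope.

Lemma fractionE (R : idomainType) (f : {fraction R}) :
  exists n d : R, f = tofrac n / tofrac d.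
Proof.
elim/generic_quotient.quotW: f => f.
exists (frac f).1, (frac f).2; apply/esym.
rewrite /GRing.inv /GRing.mul /= !generic_quotient.piE.
rewrite /FracField.mulf /FracField.invf.
by rewrite !numden_Ratio ?oner_eq0 ?denom_ratioP // mulr1 mul1r Ratio_numden.
Qed.

Section Cluster.
Variable P : torsionFreeZmodType.

Local Notation ZP := (group_ring int P).

(* Frac(ZP) and F = Frac(ZP)(x_1, x_2, x_3); indices run over 0, 1, 2. *)
Definition base_field : fieldType := {fraction ZP}.
Definition ambient : fieldType := {fraction {mpoly base_field[3]}}.

Definition of_base (c : base_field) : ambient := tofrac (c%:MP_[3]).
Definition of_ring (a : ZP) : ambient := of_base (tofrac a).
Definition of_coef (p : P) : ambient := of_ring (GroupRing.of_group int p).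
Definition xvar (i : 'I_3) : ambient := tofrac 'X_i.

(* The ZP-subalgebra of F generated by S. *)
Inductive alg_gen (S : ambient -> Prop) : ambient -> Prop :=
| alg_gen_ring a : alg_gen S (of_ring a)
| alg_gen_in f : S f -> alg_gen S f
| alg_gen_add f g : alg_gen S f -> alg_gen S g -> alg_gen S (f + g)
| alg_gen_mul f g : alg_gen S f -> alg_gen S g -> alg_gen S (f * g).

(* The subfield of F generated by Frac(ZP) and S. *)
Inductive field_gen (S : ambient -> Prop) : ambient -> Prop :=
| field_gen_base c : field_gen S (of_base c)
| field_gen_in f : S f -> field_gen S f
| field_gen_add f g : field_gen S f -> field_gen S g -> field_gen S (f + g)
| field_gen_mul f g : field_gen S f -> field_gen S g -> field_gen S (f * g)
| field_gen_inv f : field_gen S f -> field_gen S f^-1.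

Definition freely_generates (y : 'I_3 -> ambient) : Prop :=
  (forall q : {mpoly base_field[3]}, mmap of_base y q = 0 -> q = 0) /\
  (forall f, field_gen (fun g => exists i, g = y i) f).

Record seed := Seed {
  cluster : 'I_3 -> ambient;
  coefp : 'I_3 -> P;
  coefm : 'I_3 -> P;
  exch : 'M[int]_3;
  cluster_free : freely_generates cluster;
  exch_skew : exch^T = - exch
}.

(* The division by 2 is exact. *)
Definition mutate_mx (k : 'I_3) (B : 'M[int]_3) : 'M[int]_3 :=
  \matrix_(i, j)
    if (i == k) || (j == k) then - B i j
    else B i j + ((`|B i k| * B k j + B i k * `|B k j|)%R %/ 2)%Z.

(* The coefficients of s' in the directions j != k are constrained only through
   their quotient, so s and k determine s' only up to common factors. *)
Definition mutation (k : 'I_3) (s s' : seed) : Prop :=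
  let x := cluster s in
  let B := exch s in
  [/\ forall j, j != k -> cluster s' j = x j,
      x k * cluster s' k =
           of_coef (coefp s k) * \prod_(i | 0 < B k i) x i ^ B k i
         + of_coef (coefm s k) * \prod_(i | B k i < 0) x i ^ (- B k i),
      exch s' = mutate_mx k B,
      coefp s' k = coefm s k /\ coefm s' k = coefp s k
    & forall j, j != k ->
        coefp s' j - coefm s' j =
          (if 0 <= B j k then coefp s k else coefm s k) *~ B j k
          + (coefp s j - coefm s j)].

Definition mutation_equivalent : seed -> seed -> Prop :=
  clos_refl_trans seed (fun s s' => exists k, mutation k s s').

Definition laurent_ring (y : 'I_3 -> ambient) : ambient -> Prop :=
  alg_gen (fun f => exists i, f = y i \/ f = (y i)^-1).

Definition upper_cluster_algebra (s : seed) (f : ambient) : Prop :=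
  forall t, mutation_equivalent s t -> laurent_ring (cluster t) f.

(* U is finitely generated as a ZP-algebra. *)
Definition finitely_generated (U : ambient -> Prop) : Prop :=
  exists gens : seq ambient, forall f, U f <-> alg_gen (fun g => g \in gens) f.

Lemma of_base_is_zmod_morphism : zmod_morphism of_base.
Proof. by move=> a b; rewrite /of_base mpolyCB tofracB. Qed.

Lemma of_base_is_monoid_morphism : monoid_morphism of_base.
Proof.
by split=> [|a b]; rewrite /of_base ?mpolyC1 ?tofrac1 // mpolyCM tofracM.
Qed.

HB.instance Definition _ :=
  GRing.isZmodMorphism.Build base_field ambient of_base of_base_is_zmod_morphism.
HB.instance Definition _ :=
  GRing.isMonoidMorphism.Build base_field ambient of_base
    of_base_is_monoid_morphism.

Lemma mmap_xvar (q : {mpoly base_field[3]}) :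
  mmap of_base xvar q = tofrac q :> ambient.
Proof.
rewrite [in RHS](mpolyE q) raddf_sum /mmap; apply: eq_bigr => m _.
rewrite -mul_mpolyC /= tofracM; congr (_ * _).
rewrite /mmap1 mpolyXE_id rmorph_prod /=; apply: eq_bigr => i _.
by rewrite rmorphXn.
Qed.

Lemma xvar_free : freely_generates xvar.
Proof.
split=> [q|f]; first by rewrite mmap_xvar => /eqP; rewrite tofrac_eq0 => /eqP.
set S := field_gen _.
have SX (g : ambient) n : S g -> S (g ^+ n).
  move=> Sg; elim: n => [|n IH]; last by rewrite exprS; apply: field_gen_mul.
  by rewrite expr0 -(rmorph1 of_base); apply: field_gen_base.
have Sp (q : {mpoly base_field[3]}) : S (tofrac q).
  rewrite -mmap_xvar /mmap; apply: (big_ind S).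
  - by rewrite -(rmorph0 of_base); apply: field_gen_base.
  - by move=> g h; apply: field_gen_add.
  move=> m _; apply: field_gen_mul; first exact: field_gen_base.
  rewrite /mmap1; apply: (big_ind S).
  - by rewrite -(rmorph1 of_base); apply: field_gen_base.
  - by move=> g h; apply: field_gen_mul.
  by move=> i _; apply: SX; apply: field_gen_in; exists i.
have [n [d ->]] := fractionE f.
exact: (field_gen_mul (Sp n) (field_gen_inv (Sp d))).
Qed.

Definition initial_seed (ap am : 'I_3 -> P) (B : 'M[int]_3) (hB : B^T = - B) :=
  Seed ap am xvar_free hB.

End Cluster.

Arguments initial_seed {P} ap am B hB.

Definition exch3 : 'M[int]_3 :=
  \matrix_(i, j) nth 0 (nth [::] [:: [::  0;  3; -3];
                                     [:: -3;  0;  3];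
                                     [::  3; -3;  0]] i) j.

Lemma exch3_skew : exch3^T = - exch3.
Proof.
by apply/matrixP=> -[[|[|[|//]]] ?] -[[|[|[|//]]] ?]; rewrite !mxE.
Qed.

(* Main.v *)
From HB Require Import structures.
From mathcomp Require Import all_boot all_order all_algebra.
From mathcomp Require Import ring lra zify.
From mathcomp Require finmap monalg mpoly.
From Stdlib Require Import Relation_Operators.
Require Import Defs.

(** Let A be the group ring of P and x_0, x_1, x_2 the initial cluster, with
    indices modulo 3. The exchange relations of the initial seed are
        x_i x_i' = a_i^+ x_{i+1}^3 + a_i^- x_{i+2}^3,
    so everything is graded by total degree. Call the right-hand side p_i. A
    Laurent polynomial in x lies in the upper cluster algebra U if and only if,
    for every i and n, the coefficient of x_i^{-n} is divisible by p_i^n.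
    Geometrically, the degree d part of U is the union over n of H^0(dH + nD) on
    the plane blown up in nine points, three on each side of the coordinate
    triangle, where D is the strict transform of the triangle. Here D^2 = 0,
    H.D = 3, and the normal bundle of D is given, up to sign, by the quotient
    prod a_i^+ / prod a_i^-, which is not torsion.

    - In degrees at most 0 there are only constants [nonpositive_degree]: an
      element with poles of order at most n has, along each side on which it has
      a pole of order n, leading coefficient proportional to p_i^n, and at the
      vertices of the triangle the three proportionality factors are compatible
      only if prod (a_i^+)^n = prod (a_i^-)^n.
    - In degree 1 the poles have unbounded order [unbounded_degree_one], because
      H^0(H + nD) has dimension at least 3n + 3: on the forms of degree 3n + 1,
      of which there are (3n+2)(3n+3)/2, divisibility imposes at most
      9n(n+1)/2 linear conditions.

    If U were generated by finitely many elements, its degree 1 part would be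
    spanned over A by the degree 1 parts of the generators, by the first point,
    so the order of the poles would be bounded [boundedM]; this contradicts the
    second point.

    The divisibility conditions involve only the initial cluster and its three
    neighbours. That they imply membership in the Laurent ring of every cluster
    is the upper bound theorem of Berenstein, Fomin and Zelevinsky
    [upper_bound_sub]: the bound does not change under mutation as long as all
    entries of the exchange matrix off the diagonal stay nonzero, and here they
    do, because their absolute values satisfy the Markov type equation
    a^2 + b^2 + c^2 = abc [markov_mutation]. *)

Set Implicit Arguments.
Unset Strict Implicit.
Unset Printing Implicit Defensive.

Import Order.TTheory GRing.Theory Num.Theory.
Local Open Scope ring_scope.

(** * Monomials, coefficients and slices in a group ring *)

Opaque GroupRing.mul GroupRing.unit GroupRing.inv monalg.fgadd monalg.fgopp monalg.fgzero.

Section GroupRingBasics.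
Import finmap monalg.
Variables (R : idomainType) (L : torsionFreeZmodType).
Local Notation RL := (group_ring R L).
Implicit Types (c d : R) (k l : L) (g h p : RL).

Definition mon c k : RL := << c *g k >>.
Definition coef g k : R := (g : {malg R[L]})@_k.
Definition supp g : seq L := msupp (g : {malg R[L]}).

Lemma coef0 k : coef 0 k = 0.
Proof. exact: mcoeff0. Qed.
Lemma coefD g h k : coef (g + h) k = coef g k + coef h k.
Proof. exact: mcoeffD. Qed.
Lemma coefB g h k : coef (g - h) k = coef g k - coef h k.
Proof. exact: mcoeffB. Qed.
Lemma coef_sum (I : Type) (r : seq I) (Q : pred I) (G : I -> RL) k :
  coef (\sum_(i <- r | Q i) G i) k = \sum_(i <- r | Q i) coef (G i) k.
Proof. exact: (big_morph _ (fun g h => coefD g h k) (coef0 k)). Qed.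

Lemma coefP g h : (forall k, coef g k = coef h k) -> g = h.
Proof. by move=> E; apply/malgP. Qed.

Lemma coef_mon c k l : coef (mon c k) l = c *+ (k == l).
Proof. exact: mcoeffU. Qed.

Lemma supp_neq0 g k : (k \in supp g) = (coef g k != 0).
Proof. by rewrite /supp mcoeff_neq0. Qed.

Lemma supp_uniq g : uniq (supp g).
Proof. exact: fset_uniq. Qed.

Lemma sum_mon g : g = \sum_(k <- supp g) mon (coef g k) k.
Proof. exact: monalgE. Qed.

Lemma mon_ind (Q : RL -> Prop) :
  (forall g h, Q g -> Q h -> Q (g + h)) -> Q 0 ->
  (forall c k, Q (mon c k)) -> forall g, Q g.
Proof.
move=> QD Q0 Qm g; rewrite [g]sum_mon.
by elim: (supp g) => [|k r IH]; rewrite ?big_nil // big_cons; exact: QD.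
Qed.

Lemma monM c d k l : mon c k * mon d l = mon (c * d) (k + l).
Proof. exact: GroupRing.mulUU. Qed.

Lemma mon1 : mon 1 0 = 1 :> RL.
Proof. by []. Qed.

Lemma monX c k n : mon c k ^+ n = mon (c ^+ n) (k *+ n).
Proof. by elim: n => [|n IH]; rewrite ?mulr0n // !exprS IH monM mulrS. Qed.

Lemma monB c d k : mon (c - d) k = mon c k - mon d k.
Proof. exact: monalgUB. Qed.

Lemma monN c k : mon (- c) k = - mon c k.
Proof. exact: monalgUN. Qed.

Lemma mon0 k : mon 0 k = 0 :> RL.
Proof. exact: monalgU0. Qed.

Lemma coef_monM c k g l : coef (mon c k * g) l = c * coef g (l - k).
Proof.
elim/mon_ind: g => [g h IHg IHh||d k'].
- by rewrite mulrDr !coefD IHg IHh mulrDr.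
- by rewrite mulr0 !coef0 mulr0.
rewrite monM !coef_mon -mulrnAr; congr (_ * (_ *+ _)).
by rewrite [in RHS]eq_sym subr_eq addrC eq_sym.
Qed.

Lemma coefM_neq0 g h k : coef (g * h) k != 0 ->
  exists l m, [/\ k = l + m, coef g l != 0 & coef h m != 0].
Proof.
rewrite {1}[g]sum_mon mulr_suml coef_sum => nz.
have: has (fun l => coef (mon (coef g l) l * h) k != 0) (supp g).
  apply: contraNT nz => /hasPn/= z; rewrite big1_seq // => l /z.
  by rewrite negbK => /eqP.
case/hasP=> l _; rewrite coef_monM mulf_eq0 negb_or => /andP[gl hl].
by exists l, (k - l); rewrite addrC subrK.
Qed.

Variable lam : {additive L -> int}.

Definition slice (v : int) g : RL :=
  \sum_(k <- supp g | lam k == v) mon (coef g k) k.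

Lemma coef_slice v g k : coef (slice v g) k = if lam k == v then coef g k else 0.
Proof.
rewrite /slice coef_sum big_mkcond /=; have [ks|ks] := boolP (k \in supp g).
  rewrite (bigD1_seq k) ?supp_uniq //= coef_mon eqxx mulr1n.
  rewrite big1 ?addr0 // => l lk; rewrite coef_mon (negbTE lk) ?mulr0n.
  by case: ifP.
rewrite big1_seq => [|l /andP[_ ls]].
  by move: ks; rewrite supp_neq0 negbK => /eqP ->; case: ifP.
rewrite coef_mon; have [lk|_] := eqVneq l k; last by case: ifP.
by case/negP: ks; rewrite -lk.
Qed.

Lemma slice_is_additive v : zmod_morphism (slice v).
Proof.
move=> g h; apply: coefP => k; rewrite coefB !coef_slice coefB.
by case: ifP => // _; rewrite subr0.
Qed.
HB.instance Definition _ v :=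
  GRing.isZmodMorphism.Build RL RL (slice v) (slice_is_additive v).

Lemma slice_mon v c k : slice v (mon c k) = if lam k == v then mon c k else 0.
Proof.
apply: coefP => l; rewrite coef_slice coef_mon.
have [->|kl] := eqVneq k l.
  by case: ifP => _; rewrite ?coef0 ?coef_mon ?eqxx.
by case: ifP; case: ifP; rewrite ?coef0 ?coef_mon ?(negbTE kl).
Qed.

Lemma sliceK v w g : slice v (slice w g) = if v == w then slice w g else 0.
Proof.
apply: coefP => k; rewrite !coef_slice; case: (eqVneq v w) => [->|vw].
  by rewrite /= coef_slice; case: (lam k == w).
by rewrite coef0; case: ifP => // /eqP ->; rewrite (negbTE vw).
Qed.

(** Homogeneity of weight [w], in the form in which it is used: multiplication by
    [p] shifts slices. *)
Definition homog (w : int) p := forall v g, slice v (p * g) = p * slice (v - w) g.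

Lemma homog_mon c k : homog (lam k) (mon c k).
Proof.
move=> v g; apply: coefP => l.
rewrite coef_slice !coef_monM coef_slice raddfB -(inj_eq (addIr (- lam k))).
by case: ifP; rewrite ?mulr0.
Qed.

Lemma homogD w p p' : homog w p -> homog w p' -> homog w (p + p').
Proof. by move=> hp hp' v g; rewrite !mulrDl raddfD /= hp hp'. Qed.

Lemma homogX w p n : homog w p -> homog (w *+ n) (p ^+ n).
Proof.
move=> hp; elim: n => [|n IH] v g; first by rewrite !expr0 !mul1r mulr0n subr0.
by rewrite exprS -!mulrA hp IH mulrS opprD addrA.
Qed.

Lemma top_coef g : g != 0 ->
  exists2 k, coef g k != 0 & forall l, lam k < lam l -> coef g l = 0.
Proof.
move=> gnz; have: supp g != [::].
  by apply: contra_neqN gnz => /eqP s0; rewrite [g]sum_mon s0 big_nil.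
suff [->|[k ks kmax] _] : supp g = [::] \/
    exists2 k, k \in supp g & forall l, l \in supp g -> lam l <= lam k.
- by [].
- exists k; first by rewrite -supp_neq0.
  move=> l kl; apply/eqP; apply: contraTT kl; rewrite -supp_neq0 => /kmax.
  by rewrite -leNgt.
elim: (supp g) => [|a s [->|[m ms mmax]]]; first by left.
  by right; exists a; rewrite ?mem_head // => l; rewrite inE => /eqP ->.
right; have [ma|am] := leP (lam m) (lam a).
  exists a; rewrite ?mem_head // => l; rewrite inE => /predU1P[->//|/mmax lm].
  exact: le_trans lm ma.
exists m; first by rewrite inE ms orbT.
by move=> l; rewrite inE => /predU1P[->|/mmax//]; exact: ltW.
Qed.

(** Only the heavier term of the binomial contributes in the top weight, so a top
    coefficient of [h] is carried along by the powers of that term. *)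
Lemma top_binomial_mul a b u v h k n : lam v < lam u ->
  (forall l, lam k < lam l -> coef h l = 0) ->
  coef ((mon a u + mon b v) ^+ n * h) (k + u *+ n) = a ^+ n * coef h k /\
  forall l, lam (k + u *+ n) < lam l -> coef ((mon a u + mon b v) ^+ n * h) l = 0.
Proof.
move=> vu hk; elim: n => [|n [IHc IH0]].
  by rewrite !expr0 !mul1r mulr0n addr0.
split=> [|l kl]; rewrite exprS -mulrA mulrDl coefD !coef_monM.
  rewrite mulrSr addrA addrK IHc (IH0 (_ - v)) ?mulr0 ?addr0 ?mulrA ?exprS //.
  by rewrite -(addrA _ u) [X in _ < X]raddfD raddfB ltrDl subr_gt0.
move: kl; rewrite mulrSr addrA [X in X < _]raddfD => kl.
rewrite !IH0 ?mulr0 ?addr0 // raddfB ltrBrDr //.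
by apply: le_lt_trans kl; rewrite lerD2l ltW.
Qed.

End GroupRingBasics.

Opaque GroupRing.one.

(** * Laurent polynomials and their evaluation at a cluster *)

Lemma int_torsion_free (p : int) (n : nat) : (0 < n)%N -> p *+ n = 0 -> p = 0.
Proof. by move=> n0 /eqP; rewrite mulrn_eq0 eqn0Ngt n0 => /eqP. Qed.
HB.instance Definition _ := Zmodule_isTorsionFree.Build int int_torsion_free.

Lemma ffun_torsion_free (I : finType) (P : torsionFreeZmodType)
  (p : {ffun I -> P}) (n : nat) : (0 < n)%N -> p *+ n = 0 -> p = 0.
Proof.
move=> n0 pn; apply/ffunP => i; rewrite ffunE.
by apply: (@torsion_free P _ n n0); rewrite -ffunMnE pn ffunE.
Qed.
HB.instance Definition _ (I : finType) (P : torsionFreeZmodType) :=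
  Zmodule_isTorsionFree.Build {ffun I -> P} (@ffun_torsion_free I P).

(** Exponent vectors. The Laurent polynomials in three variables over R are the
    group ring R[Z^3], which makes them a domain. *)
Definition Z3 : torsionFreeZmodType := {ffun 'I_3 -> int}.
Notation laurent R := (group_ring R Z3).

Definition coord (i : 'I_3) (k : Z3) : int := (k : {ffun 'I_3 -> int}) i.
Definition expo (f : 'I_3 -> int) : Z3 := [ffun i => f i].
Definition unit_expo (i : 'I_3) : Z3 := expo (fun j => (i == j)%:Z).

Lemma coord_is_additive i : zmod_morphism (coord i).
Proof. by move=> k l; rewrite /coord !ffunE. Qed.
HB.instance Definition _ i :=
  GRing.isZmodMorphism.Build Z3 int (coord i) (coord_is_additive i).

Definition deg (k : Z3) : int := \sum_i coord i k.
Lemma deg_is_additive : zmod_morphism deg.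
Proof. by move=> k l; rewrite /deg -sumrB; apply: eq_bigr => i _; rewrite raddfB. Qed.
HB.instance Definition _ := GRing.isZmodMorphism.Build Z3 int deg deg_is_additive.

Lemma expoP (k l : Z3) : (forall i, coord i k = coord i l) -> k = l.
Proof. by move=> E; apply/ffunP. Qed.

Lemma coord_expo i f : coord i (expo f) = f i.
Proof. by rewrite /coord ffunE. Qed.

Lemma coord_unit i j : coord i (unit_expo j) = (j == i)%:Z.
Proof. exact: coord_expo. Qed.

Lemma coordD i k l : coord i (k + l) = coord i k + coord i l.
Proof. exact: raddfD. Qed.
Lemma coordB i k l : coord i (k - l) = coord i k - coord i l.
Proof. exact: raddfB. Qed.
Lemma coordN i k : coord i (- k) = - coord i k.
Proof. exact: raddfN. Qed.
Lemma coordMn i k n : coord i (k *+ n) = coord i k *+ n.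
Proof. exact: raddfMn. Qed.

Section Evaluation.
Import monalg.
Variables (R : idomainType) (F : fieldType) (theta : {rmorphism R -> F}).
Implicit Types (g h : laurent R) (k l : Z3) (y : 'I_3 -> F).

Definition monev y k : F := \prod_i y i ^ coord i k.
Definition ev y g : F := monalg.mmap theta (monev y) g.

Lemma ev0 y : ev y 0 = 0. Proof. exact: mmap0. Qed.
Lemma evD y g h : ev y (g + h) = ev y g + ev y h.
Proof. exact: mmapD. Qed.
Lemma evB y g h : ev y (g - h) = ev y g - ev y h.
Proof. exact: mmapB. Qed.
Lemma ev_sum y (I : Type) (r : seq I) (Q : pred I) (G : I -> laurent R) :
  ev y (\sum_(i <- r | Q i) G i) = \sum_(i <- r | Q i) ev y (G i).
Proof. exact: (big_morph _ (evD y) (ev0 y)). Qed.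

Lemma ev_mon y c k : ev y (mon c k) = theta c * monev y k.
Proof. exact: mmapU. Qed.

Lemma monev0 y : monev y 0 = 1.
Proof. by rewrite /monev big1 // => i _; rewrite raddf0 expr0z. Qed.

Lemma monev_unit y i : monev y (unit_expo i) = y i.
Proof.
rewrite /monev (bigD1 i) //= coord_unit eqxx expr1z big1 ?mulr1 // => j ji.
by rewrite coord_unit eq_sym (negbTE ji) expr0z.
Qed.

Lemma eq_ev y z g : (forall i, y i = z i) -> ev y g = ev z g.
Proof.
move=> yz; elim/mon_ind: g => [g h IHg IHh||c k]; last 2 first.
- by rewrite !ev0.
- by rewrite !ev_mon; congr (_ * _); apply: eq_bigr => i _; rewrite yz.
by rewrite !evD IHg IHh.
Qed.

Section Nonzero.
Variable y : 'I_3 -> F.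
Hypothesis y_neq0 : forall i, y i != 0.

Lemma monevD k l : monev y (k + l) = monev y k * monev y l.
Proof.
by rewrite -big_split; apply: eq_bigr => i _; rewrite raddfD expfzDr.
Qed.

Lemma monevN k : monev y (- k) = (monev y k)^-1.
Proof.
by rewrite /monev -prodfV; apply: eq_bigr => i _; rewrite raddfN invr_expz.
Qed.

Lemma monev_neq0 k : monev y k != 0.
Proof. by apply/prodf_neq0 => i _; exact: expfz_neq0. Qed.

Lemma evM g h : ev y (g * h) = ev y g * ev y h.
Proof.
elim/mon_ind: g => [g1 g2 IH1 IH2||c k]; last 2 first.
- by rewrite mul0r ev0 mul0r.
- elim/mon_ind: h => [h1 h2 IH1 IH2||d l].
  + by rewrite mulrDr !evD IH1 IH2 mulrDr.
  + by rewrite mulr0 ev0 mulr0.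
  by rewrite monM !ev_mon monevD rmorphM /= mulrACA.
by rewrite mulrDl !evD IH1 IH2 mulrDl.
Qed.

Lemma ev1 : ev y 1 = 1.
Proof. by rewrite -mon1 ev_mon monev0 rmorph1 mulr1. Qed.

Lemma evX g n : ev y (g ^+ n) = ev y g ^+ n.
Proof. by elim: n => [|n IH]; rewrite ?ev1 // !exprS evM IH. Qed.

End Nonzero.

(** The cluster [y] is algebraically independent, in Laurent form. *)
Definition ev_inj y := forall g, ev y g = 0 -> g = 0.

(** Let y' be [y] with y_j replaced by p(y) / y_j. A Laurent polynomial in y' is
    brought back to [y] by changing the sign of the exponent of the variable j and
    collecting powers of p, nonnegative ones after multiplication by p^M. *)
Section Exchange.
Variables (y : 'I_3 -> F) (j : 'I_3) (p : laurent R).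
Hypotheses (y_neq0 : forall i, y i != 0) (y_inj : ev_inj y).
Hypotheses (p_neq0 : p != 0) (p_homog : homog (coord j) 0 p).

Definition exchanged (i : 'I_3) : F := if i == j then ev y p / y j else y i.

Definition flip (k : Z3) : Z3 := expo (fun i => if i == j then - coord i k else coord i k).

Lemma flipK : involutive flip.
Proof.
move=> k; apply: expoP => i; rewrite !coord_expo.
by case: eqP => // _; rewrite opprK.
Qed.

Lemma coord_flip k : coord j (flip k) = - coord j k.
Proof. by rewrite coord_expo eqxx. Qed.

Lemma ev_neq0 : ev y p != 0.
Proof. by apply: contraNneq p_neq0 => /y_inj ->. Qed.

Lemma exchanged_neq0 i : exchanged i != 0.
Proof.
by rewrite /exchanged; case: ifP => // _; rewrite mulf_neq0 ?invr_eq0 ?ev_neq0.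
Qed.

Lemma monev_exchanged k :
  monev exchanged k = ev y p ^ coord j k * monev y (flip k).
Proof.
rewrite /monev (bigD1 j) //= [in RHS](bigD1 j) //= mulrA coord_flip; congr (_ * _).
  by rewrite /exchanged eqxx expfzMl exprz_inv.
by apply: eq_bigr => i ij; rewrite /exchanged coord_expo (negbTE ij).
Qed.

Definition cleared (M : nat) g : laurent R :=
  \sum_(k <- supp g) p ^+ `|(M%:Z + coord j k)%R|%N * mon (coef g k) (flip k).

Lemma ev_cleared g : exists M : nat, ev exchanged g * ev y p ^+ M = ev y (cleared M g).
Proof.
pose M := (\max_(k <- supp g) `|coord j k|)%N; exists M.
rewrite /cleared ev_sum [ev _ g]/ev /monalg.mmap mulr_suml; apply: eq_big_seq => k ks.
have kM : (`|coord j k| <= M)%N by apply: leq_bigmax_seq.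
rewrite evM // evX // ev_mon /= monev_exchanged -/(coef g k).
have -> : ev y p ^+ `|(M%:Z + coord j k)%R|%N = ev y p ^+ M * ev y p ^ coord j k.
  rewrite [LHS]exprnP [_ ^+ M]exprnP -expfzDr ?ev_neq0 //; congr (_ ^ _).
  by rewrite gez0_abs //; lia.
by move: (ev y p ^+ M) (ev y p ^ _) (monev y _) (theta _) => a b c d; ring.
Qed.

(** The part of [g] that ends up in weight [v], before the power of p. *)
Definition flipped v g : laurent R :=
  \sum_(k <- supp g | coord j k == - v) mon (coef g k) (flip k).

Lemma slice_cleared M g v :
  slice (coord j) v (cleared M g) = p ^+ `|(M%:Z - v)%R|%N * flipped v g.
Proof.
rewrite raddf_sum mulr_sumr [RHS]big_mkcond; apply: eq_bigr => k _ /=.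
rewrite (homogX _ p_homog) mul0rn subr0 slice_mon /= coord_flip eqr_oppLR.
by case: eqP => [->|_]; rewrite ?mulr0.
Qed.

Lemma coef_flipped g k : coef (flipped (- coord j k) g) (flip k) = coef g k.
Proof.
rewrite /flipped opprK coef_sum big_mkcond [in RHS](sum_mon g) coef_sum.
apply: eq_bigr => l _; rewrite !coef_mon (inj_eq (inv_inj flipK)).
by have [->|] := eqVneq l k; rewrite ?eqxx //; case: ifP.
Qed.

(** The slices of the cleared polynomial are, up to powers of p, the slices of
    [g] with their exponents flipped, so none of its coefficients is lost. *)
Lemma exchanged_inj : ev_inj exchanged.
Proof.
move=> g g0; have [M] := ev_cleared g; rewrite g0 mul0r => /esym/y_inj T0.
apply: coefP => k; rewrite coef0 -coef_flipped.
have := slice_cleared M g (- coord j k); rewrite T0 raddf0 => /esym/eqP.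
by rewrite mulf_eq0 expf_eq0 (negbTE p_neq0) andbF /= => /eqP ->; rewrite coef0.
Qed.

(** Comparing coefficients of y_j^{-n}: on the side of y' this monomial comes with
    p^n. *)
Lemma slice_exchanged g g' (n : nat) : ev y g = ev exchanged g' ->
  exists h, slice (coord j) (- n%:Z) g = p ^+ n * h.
Proof.
have [M evM'] := ev_cleared g' => eq_g; exists (flipped (- n%:Z) g').
have: ev y (p ^+ M * g - cleared M g') = 0.
  by rewrite evB evM // evX // mulrC eq_g evM' subrr.
move=> /y_inj/eqP; rewrite subr_eq0 => /eqP/(congr1 (slice (coord j) (- n%:Z))).
rewrite (homogX _ p_homog) mul0rn subr0 slice_cleared opprK -PoszD absz_nat.
by rewrite exprD -mulrA => /mulfI; apply; rewrite expf_neq0.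
Qed.

End Exchange.
End Evaluation.

(** * Divisibility of slices and generation *)

Section Generation.
Variable R : idomainType.
Implicit Types (c : R) (g h p : laurent R) (k : Z3) (j : 'I_3).

Definition var (j : 'I_3) : laurent R := mon 1 (unit_expo j).
Definition var_inv j : laurent R := mon 1 (- unit_expo j).

Lemma var_invK j : var j * var_inv j = 1.
Proof. by rewrite monM mulr1 subrr mon1. Qed.

Lemma var_neq0 j : var j != 0.
Proof.
by apply: contra_neq (oner_neq0 (laurent R)) => v0; rewrite -(var_invK j) v0 mul0r.
Qed.

Definition slices_divisible j p g :=
  forall n : nat, exists h, slice (coord j) (- n%:Z) g = p ^+ n * h.

(** If p^n divides the coefficient of x_j^{-n} for all n, the element is a
    polynomial in x_j and p / x_j over the Laurent ring in the other variables:
    p^n h x_j^{-n} = (p / x_j)^n h. *)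
Lemma slices_divisible_ind j p (Q : laurent R -> Prop) :
  homog (coord j) 0 p ->
  (forall g h, Q g -> Q h -> Q (g + h)) -> Q 0 ->
  (forall c k, 0 <= coord j k -> Q (mon c k)) ->
  (forall g, Q g -> Q (p * var_inv j * g)) ->
  forall g, slices_divisible j p g -> Q g.
Proof.
move=> hp QD Q0 Qm QY g gP.
have Qslice (n : nat) : Q (slice (coord j) (- n%:Z) g).
  have [h gh] := gP n.
  have -> : slice (coord j) (- n%:Z) g =
      (p * var_inv j) ^+ n * (mon 1 (unit_expo j *+ n) * slice (coord j) (- n%:Z) h).
    have := sliceK (coord j) (- n%:Z) (- n%:Z) g; rewrite eqxx => <-.
    rewrite gh (homogX _ hp) mul0rn subr0 exprMn -mulrA; congr (_ * _).
    by rewrite mulrA monX expr1n monM mulr1 mulNrn addNr mon1 mul1r.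
  set t := mon _ _ * _; suff Qt : Q t.
    suff Qm' m : Q ((p * var_inv j) ^+ m * t) by exact: Qm'.
    elim: m => [|m IH]; first by rewrite expr0 mul1r.
    by rewrite exprS -mulrA; exact: QY.
  rewrite /t /slice mulr_sumr; apply: (big_ind Q) => // k /eqP kn.
  rewrite monM; apply: Qm; rewrite coordD coordMn coord_unit eqxx [coord j k]kn.
  by rewrite -natz; lia.
have QM (M : nat) : Q (\sum_(k <- supp g | - M%:Z <= coord j k) mon (coef g k) k).
  elim: M => [|M IH]; first by apply: (big_ind Q) => // k; rewrite oppr0; exact: Qm.
  suff -> : \sum_(k <- supp g | - M.+1%:Z <= coord j k) mon (coef g k) k =
      \sum_(k <- supp g | - M%:Z <= coord j k) mon (coef g k) k +
      slice (coord j) (- M.+1%:Z) g by apply: QD.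
  rewrite /slice !(big_mkcond (fun k => _ <= _)) !(big_mkcond (fun k => _ == _)) /=.
  rewrite -big_split; apply: eq_bigr => k _ /=.
  have [E|E|E] := ltgtP (coord j k) (- M.+1%:Z).
  - by rewrite ifF ?addr0 //; lia.
  - by rewrite ifT ?addr0 //; lia.
  by rewrite ifF ?add0r //; lia.
rewrite [g]sum_mon; set M := (\max_(k <- supp g) `|coord j k|)%N.
suff -> : \sum_(k <- supp g) mon (coef g k) k =
  \sum_(k <- supp g | - M%:Z <= coord j k) mon (coef g k) k by exact: QM.
rewrite [RHS]big_mkcond; apply: eq_big_seq => k ks.
have kM : (`|coord j k| <= M)%N by apply: leq_bigmax_seq.
by rewrite ifT //; move: (M) kM => M'; lia.
Qed.

End Generation.

(** * Normal forms modulo a variable in rank two *)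

(** The subring generated by two cluster variables xi, xj and their exchange
    partners yi, yj over a set T of coefficients closed under products and
    opposites. Modulo xj one has xi yi = A and G + D xi^b = 0, with D and G
    invertible; hence xi is invertible, with inverse - G^{-1} D xi^{b-1}, and every
    element is a combination of the xi^n yj^m with n < b [corner_reduced]. *)
Section Corner.
Variables (V : comNzRingType) (T : V -> Prop) (xi yi xj yj A B G D G' D' : V) (b : nat).
Hypotheses (T1 : T 1) (TM : forall s t, T s -> T t -> T (s * t)) (TN : forall t, T t -> T (- t)).
Hypotheses (TA : T A) (TB : T B) (TG : T G) (TD : T D) (TG' : T G') (TD' : T D').
Hypotheses (GK : G' * G = 1) (DK : D' * D = 1) (b_gt0 : (0 < b)%N).
Hypotheses (Ei : xi * yi = A + B * xj ^+ b) (Ej : xj * yj = G + D * xi ^+ b).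
Implicit Types (g h t : V).

Inductive corner : V -> Prop :=
| corner_one : corner 1
| corner_add g h : corner g -> corner h -> corner (g + h)
| corner_coef t g : T t -> corner g -> corner (t * g)
| corner_xi g : corner g -> corner (xi * g)
| corner_yi g : corner g -> corner (yi * g)
| corner_xj g : corner g -> corner (xj * g)
| corner_yj g : corner g -> corner (yj * g).

Inductive reduced : V -> Prop :=
| reduced_mon t n m : T t -> (n < b)%N -> reduced (t * xi ^+ n * yj ^+ m)
| reduced_xj g : corner g -> reduced (xj * g)
| reduced_add g h : reduced g -> reduced h -> reduced (g + h).

Lemma corner_monomial t n m : T t -> corner (t * xi ^+ n * yj ^+ m).
Proof.
move=> Tt; rewrite -mulrA; apply: corner_coef Tt _.
elim: n => [|n IH]; last by rewrite exprS -mulrA; exact: corner_xi.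
rewrite mul1r; elim: m => [|m IH]; first exact: corner_one.
by rewrite exprS; exact: corner_yj.
Qed.

Lemma corner_xjX g n : corner g -> corner (xj ^+ n * g).
Proof.
by move=> gW; elim: n => [|n IH]; rewrite ?mul1r // exprS -mulrA; exact: corner_xj.
Qed.

Lemma reduced_mul_coef t g : T t -> reduced g -> reduced (t * g).
Proof.
move=> Tt; elim=> {g} [s n m Ts nb|g gW|g h _ IHg _ IHh].
- by rewrite !mulrA; apply: reduced_mon => //; exact: TM.
- by rewrite mulrCA; apply: reduced_xj; exact: corner_coef.
by rewrite mulrDr; exact: reduced_add.
Qed.

Lemma reduced_mul_yj g : reduced g -> reduced (yj * g).
Proof.
elim=> {g} [t n m Tt nb|g gW|g h _ IHg _ IHh].
- by rewrite mulrCA -exprS; exact: reduced_mon.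
- by rewrite mulrCA; apply: reduced_xj; exact: corner_yj.
by rewrite mulrDr; exact: reduced_add.
Qed.

(** Multiplication by yi cancels a factor xi and, modulo xj, leaves A. *)
Lemma reduced_mon_yi t n m : T t -> (n < b)%N ->
  reduced (t * xi ^+ n.+1 * yj ^+ m * yi).
Proof.
move=> Tt nb.
have -> : t * xi ^+ n.+1 * yj ^+ m * yi = A * (t * xi ^+ n * yj ^+ m) +
    xj * (xj ^+ b.-1 * (B * (t * xi ^+ n * yj ^+ m))).
  rewrite [xj * _]mulrA -exprS prednK // exprSr.
  transitivity ((t * xi ^+ n * yj ^+ m) * (xi * yi)); first by ring.
  by rewrite Ei; ring.
apply: reduced_add; first by apply: reduced_mul_coef => //; exact: reduced_mon.
by apply/reduced_xj/corner_xjX/corner_coef/corner_monomial.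
Qed.

(** When the exponent of xi reaches b, xi^b = D^{-1} (xj yj - G) is used. *)
Lemma reduced_mul_xi g : reduced g -> reduced (xi * g).
Proof.
elim=> {g} [t n m Tt nb|g gW|g h _ IHg _ IHh]; last 2 first.
- by rewrite mulrCA; apply: reduced_xj; exact: corner_xi.
- by rewrite mulrDr; exact: reduced_add.
have -> : xi * (t * xi ^+ n * yj ^+ m) = t * xi ^+ n.+1 * yj ^+ m.
  by rewrite exprS; ring.
have [nb'|bn] := ltnP n.+1 b; first exact: reduced_mon.
have -> : n.+1 = b by apply/eqP; rewrite eqn_leq nb bn.
have -> : t * xi ^+ b * yj ^+ m = xj * (D' * (t * xi ^+ 0 * yj ^+ m.+1)) +
    (- D' * G) * (t * xi ^+ 0 * yj ^+ m).
  transitivity (D' * (xj * yj - G) * (t * yj ^+ m)).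
    by rewrite Ej addrC addKr [D' * _]mulrA DK; ring.
  by rewrite exprS expr0; ring.
apply: reduced_add; first by apply/reduced_xj/corner_coef/corner_monomial.
by apply: reduced_mul_coef; [exact/TM/TG/TN|exact: reduced_mon].
Qed.

(** Without a factor xi to cancel, 1 = G^{-1} (xj yj - D xi^b) creates one. *)
Lemma reduced_mul_yi g : reduced g -> reduced (yi * g).
Proof.
elim=> {g} [t [|n] m Tt nb|g gW|g h _ IHg _ IHh]; last 2 first.
- by rewrite mulrCA; apply: reduced_xj; exact: corner_yi.
- by rewrite mulrDr; exact: reduced_add.
- have -> : yi * (t * xi ^+ 0 * yj ^+ m) =
      xj * (G' * (yi * (t * xi ^+ 0 * yj ^+ m.+1))) +
      (- G' * D) * (t * xi ^+ (b.-1).+1 * yj ^+ m * yi).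
    transitivity (G' * (xj * yj - D * xi ^+ b) * (yi * (t * yj ^+ m))).
      by rewrite Ej addrK GK; ring.
    by rewrite prednK // [_ ^+ m.+1]exprS expr0; ring.
  apply: reduced_add; first by apply/reduced_xj/corner_coef/corner_yi/corner_monomial.
  apply: reduced_mul_coef; first exact/TM/TD/TN.
  by apply: reduced_mon_yi => //; rewrite prednK.
by rewrite mulrC; apply: reduced_mon_yi => //; exact: ltnW.
Qed.

Lemma corner_reduced g : corner g -> reduced g.
Proof.
elim=> {g} [|g h _ ? _ ?|t g ? _ ?|g _ ?|g _ ?|g gW _|g _ ?].
- have -> : 1 = 1 * xi ^+ 0 * yj ^+ 0 by rewrite !expr0 !mulr1.
  exact: reduced_mon.
- exact: reduced_add.
- exact: reduced_mul_coef.
- exact: reduced_mul_xi.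
- exact: reduced_mul_yi.
- exact: reduced_xj.
exact: reduced_mul_yj.
Qed.

End Corner.

Opaque mon coef.

(** * From divisible slices to the corner ring *)

Section Spread.
Variables (R : idomainType) (L : torsionFreeZmodType) (lam : {additive L -> int}).

Lemma binomial_spread (a b : R) (u v : L) n (h : group_ring R L) :
  a != 0 -> b != 0 -> lam v < lam u -> h != 0 ->
  exists k l, [/\ lam l <= lam k,
    coef ((mon a u + mon b v) ^+ n * h) (k + u *+ n) = a ^+ n * coef h k,
    coef ((mon a u + mon b v) ^+ n * h) (l + v *+ n) = b ^+ n * coef h l,
    coef h k != 0 & coef h l != 0].
Proof.
move=> a0 b0 vu h0; have [k hk kmax] := top_coef lam h0.
have [l hl lmin] := top_coef (GRing.opp \o lam) h0.
exists k, l; split=> //.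
- by rewrite leNgt; apply: contra hl => /kmax ->.
- by have [-> _] := top_binomial_mul a b n vu kmax.
rewrite [mon a u + _]addrC.
have [||-> _] // := @top_binomial_mul _ _ (GRing.opp \o lam) b a v u h l n.
by rewrite /= ltrN2.
Qed.

End Spread.

(** The monomials in the variable other than i and j. *)
Definition third (i j : 'I_3) (k : Z3) := coord i k = 0 /\ coord j k = 0.

(** The exchange polynomials in two directions i and j have the shape of
    [bin_last] and [bin_first]: a monomial in the third variable plus the b-th power
    of the other variable, with the same b since the matrix is skew-symmetric. *)
Section Descent.
Variable R : idomainType.
Variables (i j : 'I_3) (alpha beta gamma delta : R) (u v : Z3) (b : nat).
Hypotheses (ij : i != j) (b_gt0 : (0 < b)%N).
Hypotheses (gamma_unit : gamma \is a GRing.unit) (delta_unit : delta \is a GRing.unit).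
Hypotheses (u_third : third i j u) (v_third : third i j v).
Implicit Types (c : R) (g h w r s : laurent R) (k : Z3).

Let X := @var R.
Definition bin_last : laurent R := mon alpha u + mon beta (unit_expo j *+ b).
Definition bin_first : laurent R := mon delta (unit_expo i *+ b) + mon gamma v.

Definition third_monomial g := exists c k, third i j k /\ g = mon c k.
Definition local_corner :=
  corner third_monomial (X i) (bin_last * var_inv R i) (X j) (bin_first * var_inv R j).

Lemma third0 : third i j 0. Proof. by split; exact: raddf0. Qed.

Lemma third_monomial1 : third_monomial 1.
Proof. by exists 1, 0; split; [exact: third0|rewrite mon1]. Qed.

Lemma third_monomialM g h : third_monomial g -> third_monomial h -> third_monomial (g * h).
Proof.
move=> [c [k [[ki kj] ->]]] [d [l [[li lj] ->]]]; exists (c * d), (k + l).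
by rewrite monM; split=> //; split; rewrite coordD ?ki ?kj ?li ?lj.
Qed.

Lemma third_monomialN g : third_monomial g -> third_monomial (- g).
Proof. by move=> [c [k [k3 ->]]]; exists (- c), k; rewrite monN. Qed.

Lemma third_mon c k : third i j k -> third_monomial (mon c k).
Proof. by exists c, k. Qed.

Lemma corner0 : local_corner 0.
Proof.
have := corner_coef (third_mon 0 third0)
  (corner_one third_monomial (X i) (bin_last * var_inv R i) (X j) (bin_first * var_inv R j)).
by rewrite mon0 mul0r.
Qed.

Lemma homog_bin_first : homog (coord j) 0 bin_first.
Proof.
apply: homogD; [have -> : 0 = coord j (unit_expo i *+ b)|have -> : 0 = coord j v];
  try exact: homog_mon; last by case: v_third.
by rewrite coordMn coord_unit (negbTE ij) mul0rn.
Qed.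

(** What a combination of the xi^n yj^m with n < b looks like as a Laurent
    polynomial: no positive powers of xj, and the coefficient of xj^{-m} is the m-th
    power of the exchange polynomial times something of degree < b in xi. *)
Definition standard s :=
  (forall n : int, 0 < n -> slice (coord j) n s = 0) /\
  (forall m : nat, exists2 r, slice (coord j) (- m%:Z) s = bin_first ^+ m * r &
     forall k, coef r k != 0 -> 0 <= coord i k < b%:Z).

Lemma reduced_standard g :
  reduced third_monomial (X i) (bin_last * var_inv R i) (X j) (bin_first * var_inv R j) b g ->
  exists s w, [/\ standard s, local_corner w & g = s + X j * w].
Proof.
elim=> {g} [t n m [c [k [[ki kj] ->]]] nb|g gW|_ _ _ [s [w [sS wW ->]]] _ [s' [w' [sS' wW' ->]]]].
- exists (mon c k * X i ^+ n * (bin_first * var_inv R j) ^+ m).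
  pose l := k + unit_expo i *+ n - unit_expo j *+ m.
  have E : mon c k * X i ^+ n * (bin_first * var_inv R j) ^+ m = bin_first ^+ m * mon c l.
    by rewrite exprMn /X /var /var_inv !monX monM mulrCA monM !expr1n !mulr1 mulNrn.
  have lj : coord j l = - m%:Z.
    rewrite /l coordB coordD !coordMn !coord_unit eqxx (negbTE ij) kj mul0rn.
    by rewrite addr0 sub0r natz.
  have li : coord i l = n%:Z.
    rewrite /l coordB coordD !coordMn !coord_unit eqxx eq_sym (negbTE ij) ki mul0rn.
    by rewrite add0r subr0 natz.
  have slE z : slice (coord j) z (bin_first ^+ m * mon c l) =
      if - m%:Z == z then bin_first ^+ m * mon c l else 0.
    rewrite (homogX _ homog_bin_first) mul0rn subr0 slice_mon /= lj.
    by case: ifP => _; rewrite ?mulr0.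
  exists 0; split; [|exact: corner0|by rewrite mulr0 addr0].
  rewrite E; split=> [z z0|m']; rewrite slE.
    by rewrite ifF //; apply/negbTE; rewrite eq_sym; apply/eqP; lia.
  case: eqP => [/oppr_inj[<-]|_].
    exists (mon c l) => [|k']; first by [].
    rewrite coef_mon; have [<- _|_] := eqVneq l k'; last by rewrite mulr0n eqxx.
    by rewrite li; lia.
  by exists 0; rewrite ?mulr0 // => k'; rewrite coef0 eqxx.
- exists 0, g; rewrite add0r; split=> //; split=> [z _|m]; rewrite raddf0 //.
  by exists 0; rewrite ?mulr0 // => k'; rewrite coef0 eqxx.
exists (s + s'), (w + w'); rewrite mulrDr addrACA; split=> //; last exact: corner_add.
case: sS sS' => [s0 sm] [s0' sm']; split=> [z z0|m].
  by rewrite raddfD /= s0 // s0' // addr0.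
have [r rE rl] := sm m; have [r' rE' rl'] := sm' m; exists (r + r').
  by rewrite raddfD /= rE rE' mulrDr.
move=> k; rewrite coefD; have [->|/rl//] := eqVneq (coef r k) 0.
by rewrite add0r; exact: rl'.
Qed.

Lemma gamma_neq0 : gamma != 0. Proof. by apply: contraTneq gamma_unit => ->; rewrite unitr0. Qed.
Lemma delta_neq0 : delta != 0. Proof. by apply: contraTneq delta_unit => ->; rewrite unitr0. Qed.

(** A nonzero multiple of an exchange polynomial, which has extreme terms 1 and
    xi^b up to units and the third variable, spreads over at least b + 1 exponents
    of xi. *)
Lemma small_multiple_eq0 r h : r = bin_first * h ->
  (forall k, coef r k != 0 -> 0 <= coord i k < b%:Z) -> r = 0.
Proof.
move=> rE rl; have [h0|h0] := eqVneq h 0; first by rewrite rE h0 mulr0.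
have vi : coord i v < coord i (unit_expo i *+ b).
  case: v_third => -> _.
  by rewrite coordMn coord_unit eqxx natz; lia.
have [k [l [lk Ek El hk hl]]] :=
  binomial_spread (lam := coord i) 1 delta_neq0 gamma_neq0 vi h0.
move: Ek El; rewrite !expr1 -rE !mulr1n => Ek El.
have := rl (k + unit_expo i *+ b); rewrite Ek mulf_neq0 ?delta_neq0 // => /(_ isT).
have := rl (l + v); rewrite El mulf_neq0 ?gamma_neq0 // => /(_ isT).
rewrite !coordD coordMn coord_unit eqxx natz; case: v_third => -> _.
by move: lk => /=; lia.
Qed.

(** [Q] stands for membership in the Laurent ring of the neighbour in direction
    j. *)
Section Predicate.
Variable Q : laurent R -> Prop.
Hypotheses (QB : forall g h, Q g -> Q h -> Q (g - h)).
Hypotheses (QM : forall g h, Q g -> Q h -> Q (g * h)).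
Hypotheses (cornerQ : forall g, local_corner g -> Q g).
Hypotheses (QS : forall g, Q g -> slices_divisible j bin_first g).

Lemma xi_yi : X i * (bin_last * var_inv R i) = mon alpha u + mon beta 0 * X j ^+ b.
Proof. by rewrite mulrCA var_invK mulr1 /X /var monX monM expr1n mulr1 add0r. Qed.

Lemma xj_yj : X j * (bin_first * var_inv R j) = mon gamma v + mon delta 0 * X i ^+ b.
Proof. by rewrite mulrCA var_invK mulr1 /X /var monX monM expr1n mulr1 add0r addrC. Qed.

(** Write xj g = s + xj w with s standard. Since g - w satisfies the divisibility
    conditions in direction j, the coefficient of xj^{-m} in s = xj (g - w) is
    divisible by one more power of the exchange polynomial than its shape shows;
    by [small_multiple_eq0] s vanishes, and g = w. *)
Lemma corner_descent g : Q g -> local_corner (X j * g) -> local_corner g.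
Proof.
move=> Qg gW.
have/reduced_standard : reduced third_monomial (X i) (bin_last * var_inv R i) (X j) (bin_first * var_inv R j) b (X j * g).
  apply: (@corner_reduced _ _ _ _ _ _ (mon alpha u) (mon beta 0) (mon gamma v)
    (mon delta 0) (mon gamma^-1 (- v)) (mon delta^-1 0) b third_monomial1) gW => //.
  - exact: third_monomialM.
  - exact: third_monomialN.
  - exact: third_mon u_third.
  - exact: third_mon third0.
  - exact: third_mon v_third.
  - exact: third_mon third0.
  - by apply: third_mon; case: v_third => vi vj; split; rewrite coordN ?vi ?vj.
  - exact: third_mon third0.
  - by rewrite monM mulVr // addNr mon1.
  - by rewrite monM mulVr // addr0 mon1.
  - exact: xi_yi.
  exact: xj_yj.
case=> s [w [[s0 sm] wW gE]].
suff -> : g = w by [].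
apply: (mulfI (var_neq0 R j)); rewrite [LHS]gE; apply/eqP.
rewrite -subr_eq0 addrK; apply/eqP/coefP => k; rewrite coef0.
have sE : s = X j * (g - w) by rewrite mulrBr [X j * g]gE addrK.
have [k0|k0] := ltP 0 (coord j k).
  by have := coef_slice (coord j) (coord j k) s k; rewrite s0 // coef0 eqxx.
have [m km] : exists m : nat, coord j k = - m%:Z.
  by exists `|coord j k|%N; rewrite lez0_abs // opprK.
have [r rE rl] := sm m; have [h hE] := QS (QB Qg (cornerQ wW)) m.+1.
suff r0 : r = 0.
  have := coef_slice (coord j) (coord j k) s k.
  by rewrite {1}km rE r0 mulr0 coef0 eqxx.
refine (small_multiple_eq0 (h := X j * h) _ rl).
have : bin_first ^+ m != 0.
  rewrite expf_neq0 //; apply/eqP => first0.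
  have := coef0 R (unit_expo i *+ b); rewrite -first0 coefD !coef_mon eqxx.
  rewrite (_ : v == _ = false) ?addr0; first by move/eqP; rewrite (negbTE delta_neq0).
  apply/negbTE/eqP => vE; case: v_third; rewrite vE coordMn coord_unit eqxx natz.
  by lia.
move/mulfI; apply; rewrite -rE sE.
have hX : homog (coord j) 1 (X j).
  by have := homog_mon (coord j) (1 : R) (unit_expo j); rewrite /= coord_unit eqxx.
rewrite hX (_ : - m%:Z - 1 = - m.+1%:Z) ?hE ?exprSr; last by lia.
by ring.
Qed.

Lemma corner_nonneg_mon c k : 0 <= coord i k -> 0 <= coord j k -> local_corner (mon c k).
Proof.
move=> ki kj; set n := `|coord i k|%N; set m := `|coord j k|%N.
pose l := k - unit_expo i *+ n - unit_expo j *+ m.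
have l3 : third i j l.
  split; rewrite /l !coordB !coordMn !coord_unit eqxx ?[j == i]eq_sym (negbTE ij).
    by rewrite mul0rn natz gez0_abs // subrr subr0.
  by rewrite mul0rn natz gez0_abs // subr0 subrr.
have -> : mon c k = X j ^+ m * (mon c l * X i ^+ n * (bin_first * var_inv R j) ^+ 0).
  rewrite expr0 mulr1 /X /var !monX !monM !expr1n mulr1 mul1r; congr mon.
  by rewrite /l (addrAC k) subrK [RHS]addrC subrK.
exact/corner_xjX/corner_monomial/third_mon.
Qed.

(** Divisibility in direction i puts a multiple of g by a power of xj into the
    corner ring; this power is then removed by [corner_descent]. *)
Lemma corner_of_slices g : Q g -> slices_divisible i bin_last g -> local_corner g.
Proof.
move=> Qg gi.
have QX : Q (X j).
  apply: cornerQ; rewrite -[X j]mulr1; apply: corner_xj; exact: corner_one.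
have hpi : homog (coord i) 0 bin_last.
  apply: homogD; [have -> : 0 = coord i u|have -> : 0 = coord i (unit_expo j *+ b)];
    try exact: homog_mon; first by case: u_third.
  by rewrite coordMn coord_unit eq_sym (negbTE ij) mul0rn.
have [n gn] : exists n : nat, local_corner (X j ^+ n * g).
  move: g gi {Qg}; apply: (slices_divisible_ind hpi).
  - move=> g h [n gn] [m hm]; exists (m + n)%N; rewrite mulrDr.
    apply: corner_add; first by rewrite exprD -mulrA; exact: corner_xjX.
    by rewrite addnC exprD -mulrA; exact: corner_xjX.
  - by exists 0%N; rewrite mulr0; exact: corner0.
  - move=> c k ki; exists `|coord j k|%N.
    rewrite /X /var monX monM expr1n mul1r; apply: corner_nonneg_mon.
      by rewrite coordD coordMn coord_unit eq_sym (negbTE ij) mul0rn add0r.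
    by rewrite coordD coordMn coord_unit eqxx natz; lia.
  by move=> g [n gn]; exists n; rewrite mulrCA; exact: corner_yi.
elim: n gn => [|n IH]; first by rewrite mul1r.
rewrite exprS -mulrA => /corner_descent gn; apply/IH/gn.
elim: n {IH gn} => [|n IH]; first by rewrite mul1r.
by rewrite exprS -mulrA; exact: QM.
Qed.

End Predicate.
End Descent.

Lemma bin_first_last (R : idomainType) i (ga de : R) v b : bin_first i ga de v b = bin_last i ga de v b.
Proof. exact: addrC. Qed.

(** * Laurent rings in the ambient field *)

Lemma coord_bound (R : idomainType) (g : laurent R) :
  exists N : nat, forall k i, k \in supp g -> (`|coord i k| <= N)%N.
Proof.
exists (\max_(k <- supp g) \max_i `|coord i k|)%N => k i ks.
apply: (@leq_trans (\max_i `|coord i k|)%N).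
  exact: (leq_bigmax (F := fun i => `|coord i k|%N)).
by apply: (leq_bigmax_seq (F := fun k => \max_i `|coord i k|)%N).
Qed.

Section Ambient.
Variable P : torsionFreeZmodType.
Local Notation ZP := (group_ring int P).
Local Notation K := (base_field P).
Local Notation F := (ambient P).
Implicit Types (y z : 'I_3 -> F) (f : F).

Lemma of_ring_is_zmod_morphism : zmod_morphism (@of_ring P).
Proof. by move=> a b; rewrite /of_ring tofracB rmorphB. Qed.
Lemma of_ring_is_monoid_morphism : monoid_morphism (@of_ring P).
Proof. by split=> [|a b]; rewrite /of_ring ?tofrac1 ?tofracM (rmorph1,rmorphM). Qed.
HB.instance Definition _ :=
  GRing.isZmodMorphism.Build ZP F (@of_ring P) of_ring_is_zmod_morphism.
HB.instance Definition _ :=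
  GRing.isMonoidMorphism.Build ZP F (@of_ring P) of_ring_is_monoid_morphism.

Lemma alg_gen_sub (S T : F -> Prop) f :
  (forall g, S g -> alg_gen T g) -> alg_gen S f -> alg_gen T f.
Proof.
move=> ST; elim=> [a|g /ST//|g h _ ? _ ?|g h _ ? _ ?].
- exact: alg_gen_ring.
- exact: alg_gen_add.
exact: alg_gen_mul.
Qed.

Lemma alg_gen0 (S : F -> Prop) : alg_gen S 0.
Proof. by rewrite -(rmorph0 (@of_ring P)); exact: alg_gen_ring. Qed.
Lemma alg_gen1 (S : F -> Prop) : alg_gen S 1.
Proof. by rewrite -(rmorph1 (@of_ring P)); exact: alg_gen_ring. Qed.
Lemma alg_genN (S : F -> Prop) f : alg_gen S f -> alg_gen S (- f).
Proof.
move=> Sf; rewrite -mulN1r -(rmorph1 (@of_ring P)) -rmorphN.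
by apply: alg_gen_mul Sf; exact: alg_gen_ring.
Qed.
Lemma alg_genB (S : F -> Prop) f g : alg_gen S f -> alg_gen S g -> alg_gen S (f - g).
Proof. by move=> Sf Sg; apply: alg_gen_add Sf _; exact: alg_genN. Qed.
Lemma alg_genX (S : F -> Prop) f n : alg_gen S f -> alg_gen S (f ^+ n).
Proof.
move=> Sf; elim: n => [|n IH]; first exact: alg_gen1.
by rewrite exprS; exact: alg_gen_mul.
Qed.

Lemma laurent_ring_eq y z f : (forall i, y i = z i) -> laurent_ring y f -> laurent_ring z f.
Proof.
by move=> yz; apply: alg_gen_sub => g [i gi]; apply: alg_gen_in; exists i; rewrite -yz.
Qed.

Lemma laurent_ring_varz y i (n : int) : laurent_ring y (y i ^ n).
Proof.
case: n => n; first by apply: alg_genX; apply: alg_gen_in; exists i; left.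
by rewrite NegzE -exprz_inv; apply: alg_genX; apply: alg_gen_in; exists i; right.
Qed.

Lemma laurent_ring_monev y (k : Z3) : laurent_ring y (monev y k).
Proof.
rewrite /monev; apply: big_ind; first exact: alg_gen1.
  by move=> *; exact: alg_gen_mul.
by move=> i _; exact: laurent_ring_varz.
Qed.

Lemma laurent_ring_mon y c k : laurent_ring y (ev (@of_ring P) y (mon c k)).
Proof.
by rewrite ev_mon; apply: alg_gen_mul; [exact: alg_gen_ring|exact: laurent_ring_monev].
Qed.

Lemma laurent_ring_ev y g : laurent_ring y (ev (@of_ring P) y g).
Proof.
elim/mon_ind: g => [g h Lg Lh||c k]; last exact: laurent_ring_mon.
  by rewrite evD; exact: alg_gen_add.
by rewrite ev0; exact: alg_gen0.
Qed.

(** Together with [laurent_ring_ev]: the Laurent ring of [y] is the image of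
    evaluation. *)
Lemma laurent_ringP y f : (forall i, y i != 0) ->
  laurent_ring y f -> exists g, f = ev (@of_ring P) y g.
Proof.
move=> y0; elim=> [a|_ [i [->|->]]|_ _ _ [g ->] _ [h ->]|_ _ _ [g ->] _ [h ->]].
- by exists (mon a 0); rewrite ev_mon monev0 mulr1.
- by exists (mon 1 (unit_expo i)); rewrite ev_mon monev_unit rmorph1 mul1r.
- by exists (mon 1 (- unit_expo i)); rewrite ev_mon monevN ?monev_unit ?rmorph1 ?mul1r.
- by exists (g + h); rewrite evD.
by exists (g * h); rewrite evM.
Qed.

Import mpoly.

Lemma free_neq0 y : freely_generates y -> forall i, y i != 0.
Proof.
case=> yfree _ i; apply/eqP => yi0.
have /yfree : mmap (@of_base P) y 'X_i = 0 by rewrite mmapX mmap1U.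
move/(congr1 (mcoeff U_(i)%MM))/eqP; rewrite mcoeffXU eqxx mcoeff0.
exact/negP/oner_neq0.
Qed.

Section FreeInjective.
Variables (R : idomainType) (theta : {rmorphism R -> F}) (iota : {rmorphism R -> K}).
Hypotheses (theta_iota : forall a, theta a = of_base (iota a)).
Hypotheses (iota_inj : forall a, iota a = 0 -> a = 0).

(** A Laurent polynomial times a large monomial is a polynomial, and freeness
    speaks of polynomials. *)
Lemma free_ev_inj y : freely_generates y -> ev_inj theta y.
Proof.
move=> yF g g0; have y0 := free_neq0 yF; case: yF => yfree _.
have [N kN] := coord_bound g.
pose m (k : Z3) : 'X_{1..3} := [multinom `|(N%:Z + coord i k)%R|%N | i < 3].
pose q : {mpoly K[3]} := \sum_(k <- supp g) iota (coef g k) *: 'X_[m k].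
have q0 : q = 0.
  apply: yfree; rewrite /q raddf_sum.
  transitivity (ev theta y g * \prod_i y i ^+ N); last by rewrite g0 mul0r.
  rewrite [ev _ _ g]/ev /monalg.mmap mulr_suml; apply: eq_big_seq => k ks.
  rewrite /= mmapZ mmapX -/(coef g k) theta_iota -mulrA -big_split; congr (_ * _).
  apply: eq_bigr => i _ /=; rewrite mnmE mulrC exprnP [in RHS]exprnP -expfzDr //.
  by congr (_ ^ _); rewrite gez0_abs //; move: (kN k i ks); lia.
apply: coefP => k; rewrite coef0; apply/eqP; apply: contraT; rewrite -supp_neq0 => ks.
have := congr1 (mcoeff (m k)) q0; rewrite mcoeff0 raddf_sum (bigD1_seq k) ?supp_uniq //=.
rewrite mcoeffZ mcoeffX eqxx mulr1 big1_seq ?addr0 => [/iota_inj k0|l /andP[lk ls]].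
  by move: ks; rewrite supp_neq0 k0 eqxx.
rewrite mcoeffZ mcoeffX; case: eqP => [/mnmP E|]; last by rewrite mulr0.
case/eqP: lk; apply: expoP => i; move: (E i); rewrite !mnmE.
by move: (kN _ i ks) (kN _ i ls); lia.
Qed.

End FreeInjective.

Lemma of_ring_ev_inj y : freely_generates y -> ev_inj (@of_ring P) y.
Proof.
apply: (@free_ev_inj _ _ (@tofrac ZP)) => // a /eqP.
by rewrite tofrac_eq0 => /eqP.
Qed.

Lemma of_base_ev_inj y : freely_generates y -> ev_inj (@of_base P) y.
Proof. by apply: (@free_ev_inj _ _ idfun) => // a. Qed.

Lemma ev_inj_free y q : ev_inj (@of_base P) y -> mmap (@of_base P) y q = 0 -> q = 0.
Proof.
move=> yinj q0; pose e (m : 'X_{1..3}) := expo (fun i => (m i)%:Z).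
have einj : injective e.
  move=> m n E; apply/mnmP => i.
  by have := congr1 (coord i) E; rewrite /e !coord_expo; case.
have /yinj g0 : ev (@of_base P) y (\sum_(m <- msupp q) mon q@_m (e m)) = 0.
  rewrite ev_sum -[RHS]q0; apply: eq_bigr => m _; rewrite ev_mon; congr (_ * _).
  by apply: eq_bigr => i _; rewrite coord_expo.
apply/mpolyP => m; rewrite mcoeff0; apply/eqP; apply: contraT; rewrite -mcoeff_msupp => ms.
have := congr1 (fun g => coef g (e m)) g0; rewrite /= coef0 coef_sum (bigD1_seq m) ?msupp_uniq //=.
rewrite coef_mon eqxx mulr1n big1 ?addr0 => [/eqP|n nm].
  by rewrite mcoeff_eq0 ms.
by rewrite coef_mon (inj_eq einj) (negbTE nm).
Qed.

End Ambient.

Opaque ev monev of_base.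

(** * Two consecutive mutations *)

(** Here zi is the partner of yi in the given cluster, and zj the partner of yj in
    the cluster mutated at i. The partner of yj in the given cluster is the
    left-hand side; to express it by the others, multiply the relation for yj zj by
    yi^b, expand (yi zi)^b and use the compatibility of the coefficients. *)
Lemma two_step_identity (E : fieldType) (al ga de ga' de' u v v' yi yj zi zj q : E) b :
  yj != 0 -> de != 0 -> ga' != 0 -> v' != 0 ->
  yj * zj = ga' * v' + de' * zi ^+ b ->
  (yi * zi) ^+ b = (al * u) ^+ b + yj * q ->
  v * v' = u ^+ b -> ga * ga' = de * de' * al ^+ b ->
  (de * yi ^+ b + ga * v) / yj = de * ga'^-1 * v'^-1 * (yi ^+ b * zj - de' * q).
Proof.
move=> yj0 de0 ga'0 v'0 yzj yzi vv' gaga'.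
apply: (mulIf yj0); rewrite divfK //.
have yq : yj * q = (yi * zi) ^+ b - (al * u) ^+ b by rewrite yzi addrC addKr.
transitivity (de / ga' / v' * (yi ^+ b * (yj * zj) - de' * (yj * q))); last by ring.
have yb : de' * (al * u) ^+ b = ga * ga' / de * (v * v').
  by rewrite gaga' vv' exprMn; field.
have -> : de' * (yj * q) = de' * (yi * zi) ^+ b - ga * ga' / de * (v * v').
  by rewrite yq mulrBr yb.
rewrite yzj exprMn; field.
by rewrite de0 v'0 ga'0.
Qed.

Section Step.
Variable P : torsionFreeZmodType.
Local Notation ZP := (group_ring int P).
Local Notation F := (ambient P).
Local Notation evr := (ev (@of_ring P)).
Implicit Types (y z : 'I_3 -> F) (f : F).

Definition grp (p : P) : ZP := GroupRing.of_group int p.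

Lemma grpD p q : grp (p + q) = grp p * grp q.
Proof. by have := GroupRing.mulUU (1 : int) 1 p q; rewrite mulr1 => /esym. Qed.
Lemma grp0 : grp 0 = 1. Proof. by []. Qed.
Lemma grpMn p n : grp (p *+ n) = grp p ^+ n.
Proof. by elim: n => [|n IH]; rewrite ?grp0 // mulrS grpD IH exprS. Qed.
Lemma grp_unit p : grp p \is a GRing.unit.
Proof. by apply/unitrPr; exists (grp (- p)); rewrite -grpD subrr grp0. Qed.
Lemma grp_neq0 p : grp p != 0.
Proof. by apply: contraTneq (grp_unit p) => ->; rewrite unitr0. Qed.

Lemma of_coefE (p : P) : of_coef p = of_ring (grp p). Proof. by []. Qed.
Lemma of_coefD (p q : P) : of_coef (p + q) = of_coef p * of_coef q.
Proof. by rewrite !of_coefE grpD rmorphM. Qed.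
Lemma of_coefMn (p : P) n : of_coef (p *+ n) = of_coef p ^+ n.
Proof. by rewrite !of_coefE grpMn rmorphXn. Qed.
Lemma of_coef0 : of_coef (0 : P) = 1.
Proof. by rewrite of_coefE grp0 rmorph1. Qed.
Lemma of_coef_neq0 (p : P) : of_coef p != 0.
Proof.
apply: contraTneq (oner_neq0 F) => p0.
by rewrite -of_coef0 -(subrr p) of_coefD p0 mul0r eqxx.
Qed.
Lemma of_coefN (p : P) : of_coef (- p) = (of_coef p)^-1.
Proof.
by apply: (mulfI (of_coef_neq0 p)); rewrite mulfV ?of_coef_neq0 // -of_coefD subrr of_coef0.
Qed.

(** Supplies the q of [two_step_identity]: all terms of the binomial expansion but
    the first are divisible by [x]. *)
Lemma expD_mul (S : F -> Prop) a b x n : alg_gen S a -> alg_gen S b -> alg_gen S x ->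
  exists2 q, alg_gen S q & (a + b * x) ^+ n = a ^+ n + x * q.
Proof.
move=> Sa Sb Sx; elim: n => [|n [q Sq E]].
  by exists 0; [exact: alg_gen0|rewrite !expr0 mulr0 addr0].
exists (a * q + b * (a ^+ n + x * q)).
  by do !apply: alg_gen_add; do !apply: alg_gen_mul => //; try apply: alg_gen_add;
     do ?apply: alg_gen_mul => //; exact: alg_genX.
by rewrite !exprS E; ring.
Qed.

Lemma monev_third i j y z k : (forall m, m != i -> m != j -> y m = z m) ->
  third i j k -> monev y k = monev z k.
Proof.
move=> yz [ki kj]; apply: eq_bigr => m _.
have [->|mi] := eqVneq m i; first by rewrite ki !expr0z.
have [->|mj] := eqVneq m j; first by rewrite kj !expr0z.
by rewrite yz.
Qed.

(** The cluster [y] is mutated at i and then at j; the third variable is not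
    touched. *)
Section TwoSteps.
Variables (y : 'I_3 -> F) (i j : 'I_3).
Variables (al be ga de : P) (u v : Z3) (b : nat).
Hypotheses (yF : freely_generates y) (ij : i != j) (b0 : (0 < b)%N).
Hypotheses (u3 : third i j u) (v3 : third i j v).

Local Notation p_i := (bin_last j (grp al) (grp be) u b).
Local Notation p_j := (bin_first i (grp ga) (grp de) v b).

Lemma corner_laurent z :
  (forall k, third i j k -> laurent_ring z (monev y k)) ->
  laurent_ring z (y i) -> laurent_ring z (evr y p_i / y i) ->
  laurent_ring z (y j) -> laurent_ring z (evr y p_j / y j) ->
  forall g, local_corner i j (grp al) (grp be) (grp ga) (grp de) u v b g ->
  laurent_ring z (evr y g).
Proof.
move=> z3 zi zi' zj zj' g; have y0 := free_neq0 yF.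
have evX k : evr y (@var ZP k) = y k by rewrite ev_mon monev_unit rmorph1 mul1r.
have evV k : evr y (@var_inv ZP k) = (y k)^-1.
  by rewrite ev_mon monevN // monev_unit rmorph1 mul1r.
elim=> {g} [|g h _ ? _ ?|_ g [c [k [k3 ->]]] _ ?|g _ ?|g _ ?|g _ ?|g _ ?].
- by rewrite ev1; exact: alg_gen1.
- by rewrite evD; exact: alg_gen_add.
- rewrite evM // ev_mon; apply: alg_gen_mul => //; apply: alg_gen_mul (z3 _ k3).
  exact: alg_gen_ring.
- by rewrite evM // evX; exact: alg_gen_mul.
- by rewrite !evM // evV; exact: alg_gen_mul.
- by rewrite evM // evX; exact: alg_gen_mul.
by rewrite !evM // evV; exact: alg_gen_mul.
Qed.

Lemma ev_bin_last : evr y p_i = of_coef al * monev y u + of_coef be * y j ^+ b.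
Proof.
rewrite evD !ev_mon; congr (_ + _ * _).
elim: b => [|n IH]; first by rewrite mulr0n expr0 monev0.
by rewrite mulrS monevD ?monev_unit ?IH ?exprS //; exact: free_neq0.
Qed.

Lemma ev_bin_first : evr y p_j = of_coef de * y i ^+ b + of_coef ga * monev y v.
Proof.
rewrite evD !ev_mon; congr (_ * _ + _).
elim: b => [|n IH]; first by rewrite mulr0n expr0 monev0.
by rewrite mulrS monevD ?monev_unit ?IH ?exprS //; exact: free_neq0.
Qed.

Lemma p_j_neq0 : p_j != 0.
Proof.
apply/eqP => first0; have := coef0 ZP (unit_expo i *+ b); rewrite -first0 coefD !coef_mon eqxx.
rewrite (_ : v == _ = false) ?addr0; first by move/eqP; rewrite mulr1n (negbTE (grp_neq0 _)).
apply/negbTE/eqP => vE; case: v3; rewrite vE coordMn coord_unit eqxx natz.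
by lia.
Qed.

(** An element of the Laurent rings of [y] and of its neighbours in directions i
    and j is a polynomial in y_i, y_j and their partners over the Laurent ring in
    the third variable. *)
Lemma laurent_to_corner f :
  laurent_ring y f ->
  laurent_ring (exchanged (@of_ring P) y i p_i) f ->
  laurent_ring (exchanged (@of_ring P) y j p_j) f ->
  exists2 g, local_corner i j (grp al) (grp be) (grp ga) (grp de) u v b g & f = evr y g.
Proof.
move=> fy fi fj; have y0 := free_neq0 yF; have yinj := of_ring_ev_inj yF.
have [g fE] := laurent_ringP y0 fy; exists g => //.
have hpj : homog (coord j) 0 p_j by exact: homog_bin_first.
have hpi : homog (coord i) 0 p_i.
  apply: homogD; [have -> : 0 = coord i u|have -> : 0 = coord i (unit_expo j *+ b)];
    try exact: homog_mon; first by case: u3.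
  by rewrite coordMn coord_unit eq_sym (negbTE ij) mul0rn.
have pi0 : p_i != 0.
  apply/eqP => p0; have := coef0 ZP u; rewrite -p0 coefD !coef_mon eqxx.
  rewrite (_ : _ == u = false) ?addr0; first by move/eqP; rewrite mulr1n (negbTE (grp_neq0 _)).
  apply/negbTE/eqP => uE; case: u3; rewrite -uE !coordMn !coord_unit eqxx natz.
  by lia.
set y' := exchanged _ y j p_j in fj.
have slices k (p h : laurent ZP) : p != 0 -> homog (coord k) 0 p ->
    laurent_ring (exchanged (@of_ring P) y k p) (evr y h) -> slices_divisible k p h.
  move=> p0 hp hk n; have [g' g'E] := laurent_ringP (exchanged_neq0 k y0 yinj p0) hk.
  exact: (slice_exchanged y0 yinj p0 hp n g'E).
rewrite fE in fi fj.
have y'i : laurent_ring y' (y i).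
  by apply: alg_gen_in; exists i; left; rewrite /y' /exchanged (negbTE ij).
have y'iV : laurent_ring y' (y i)^-1.
  by apply: alg_gen_in; exists i; right; rewrite /y' /exchanged (negbTE ij).
have third' k : third i j k -> laurent_ring y' (monev y k).
  move=> k3; rewrite (monev_third (z := y') _ k3); first exact: laurent_ring_monev.
  by move=> m _ mj; rewrite /y' /exchanged (negbTE mj).
have y'j : laurent_ring y' (y j).
  have -> : y j = evr y p_j * (y' j)^-1.
    rewrite /y' /exchanged eqxx invf_div mulrC divfK //.
    by apply: ev_neq0 yinj p_j_neq0.
  apply: alg_gen_mul; last by apply: alg_gen_in; exists j; right.
  rewrite ev_bin_first; apply: alg_gen_add; apply: alg_gen_mul; try exact: alg_gen_ring.
    exact: alg_genX.
  exact: third'.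
apply: (@corner_of_slices _ _ _ _ _ _ _ _ _ _ ij b0 (grp_unit ga) (grp_unit de) u3 v3
  (fun g => laurent_ring y' (evr y g))) => [h h'|h h'|h|h||].
- by rewrite evB; exact: alg_genB.
- by rewrite evM //; exact: alg_gen_mul.
- apply: corner_laurent.
  + exact: third'.
  + exact: y'i.
  + rewrite ev_bin_last; apply: alg_gen_mul y'iV.
    apply: alg_gen_add; apply: alg_gen_mul; try exact: alg_gen_ring.
      exact: third'.
    exact: alg_genX.
  + exact: y'j.
  by apply: alg_gen_in; exists j; left; rewrite /y' /exchanged eqxx.
- move=> hh; exact: slices (p_j_neq0) hpj hh.
- by [].
exact: slices pi0 hpi fi.
Qed.

(** All generators of the corner ring are Laurent polynomials in the cluster [z]
    obtained by two mutations: y_j from the exchange relation of z_j, then y_i from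
    that of z_i, and the partner of y_j from [two_step_identity]. *)
Lemma corner_two_step z (ga' de' : P) (v' : Z3) g :
  (forall m, m != i -> m != j -> z m = y m) ->
  z i = evr y p_i / y i -> z i != 0 -> z j != 0 ->
  y j * z j = of_coef ga' * monev y v' + of_coef de' * z i ^+ b ->
  third i j v' -> v + v' = u *+ b -> ga + ga' = de + de' + al *+ b ->
  local_corner i j (grp al) (grp be) (grp ga) (grp de) u v b g ->
  laurent_ring z (evr y g).
Proof.
move=> zy zi zi0 zj0 yzj v'3 vv' gaga'; have y0 := free_neq0 yF.
have in_z m : laurent_ring z (z m) by apply: alg_gen_in; exists m; left.
have in_zV m : laurent_ring z (z m)^-1 by apply: alg_gen_in; exists m; right.
have thirdz k : third i j k -> laurent_ring z (monev y k).
  move=> k3; rewrite (monev_third (z := z) _ k3); first exact: laurent_ring_monev.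
  by move=> m mi mj; rewrite zy.
have coefz (p : P) : laurent_ring z (of_coef p) by exact: alg_gen_ring.
have yj : laurent_ring z (y j).
  rewrite -(mulfK zj0 (y j)) yzj; apply: alg_gen_mul (in_zV j).
  apply: alg_gen_add; first exact: alg_gen_mul (coefz _) (thirdz _ v'3).
  exact: alg_gen_mul (coefz _) (alg_genX _ (in_z i)).
have yizi : y i * z i = of_coef al * monev y u + of_coef be * y j ^+ b.
  by rewrite -ev_bin_last zi mulrC (divfK (y0 i)).
have yi : laurent_ring z (y i).
  rewrite -(mulfK zi0 (y i)) yizi; apply: alg_gen_mul (in_zV i).
  apply: alg_gen_add; first exact: alg_gen_mul (coefz _) (thirdz _ u3).
  exact: alg_gen_mul (coefz _) (alg_genX _ yj).
apply: (corner_laurent thirdz yi _ yj); first by rewrite -zi.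
have [q Lq qE] : exists2 q, laurent_ring z q &
    (y i * z i) ^+ b = (of_coef al * monev y u) ^+ b + y j * q.
  have -> : y i * z i = of_coef al * monev y u + of_coef be * y j ^+ b.-1 * y j.
    by rewrite yizi -mulrA -exprSr prednK.
  apply: (expD_mul _ _ _ yj); first exact: alg_gen_mul (coefz _) (thirdz _ u3).
  exact: alg_gen_mul (coefz _) (alg_genX _ yj).
have monX n : monev y (u *+ n) = monev y u ^+ n.
  by elim: n => [|n IH]; [rewrite mulr0n monev0|rewrite mulrS monevD // IH exprS].
rewrite ev_bin_first (two_step_identity (y0 j) (of_coef_neq0 _) (of_coef_neq0 _)
  (monev_neq0 y0 v') yzj qE); first last.
- by rewrite -!of_coefMn -!of_coefD gaga'.
- by rewrite -monevD // vv' monX.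
rewrite -!of_coefN -monevN //; apply: alg_gen_mul.
  apply: alg_gen_mul (thirdz _ _); first by rewrite -of_coefD; exact: coefz.
  by case: v'3 => vi vj; split; rewrite coordN ?vi ?vj.
apply: alg_genB; last exact: alg_gen_mul (coefz _) Lq.
exact: alg_gen_mul (alg_genX _ yi) (in_z j).
Qed.

End TwoSteps.
End Step.

(** * Exchange polynomials of seeds and Markov type matrices *)

Section Seeds.
Variable P : torsionFreeZmodType.
Local Notation ZP := (group_ring int P).
Local Notation F := (ambient P).
Local Notation evr := (ev (@of_ring P)).
Implicit Types (y z : 'I_3 -> F) (f : F) (s t : seed P) (B : 'M[int]_3) (i j k l : 'I_3).

Definition pos_expo B k : Z3 := expo (fun i => if 0 < B k i then B k i else 0).
Definition neg_expo B k : Z3 := expo (fun i => if B k i < 0 then - B k i else 0).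

Definition exchange_poly s k : laurent ZP :=
  mon (grp (coefp s k)) (pos_expo (exch s) k) +
  mon (grp (coefm s k)) (neg_expo (exch s) k).

Definition neighbour s k : 'I_3 -> F :=
  exchanged (@of_ring P) (cluster s) k (exchange_poly s k).

Lemma monevE y (k : Z3) : monev y k = \prod_i y i ^ coord i k. Proof. by []. Qed.

Lemma ev_exchange_poly s k y : evr y (exchange_poly s k) =
  of_coef (coefp s k) * \prod_(i | 0 < exch s k i) y i ^ exch s k i +
  of_coef (coefm s k) * \prod_(i | exch s k i < 0) y i ^ (- exch s k i).
Proof.
rewrite evD !ev_mon; congr (_ * _ + _ * _); rewrite monevE [RHS]big_mkcond;
  by apply: eq_bigr => i _; rewrite coord_expo; case: ifP.
Qed.

Lemma seed_neq0 s i : cluster s i != 0.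
Proof. exact: free_neq0 (cluster_free s) i. Qed.

Lemma seed_inj s : ev_inj (@of_ring P) (cluster s).
Proof. exact: of_ring_ev_inj (cluster_free s). Qed.

Lemma mutation_cluster k s t : mutation k s t -> forall i, cluster t i = neighbour s k i.
Proof.
case=> other rel _ _ _ i; rewrite /neighbour /exchanged.
have [->|ik] := eqVneq i k; last exact: other.
by rewrite ev_exchange_poly -rel mulrC mulKf ?seed_neq0.
Qed.

Lemma exch_skewE s i j : exch s i j = - exch s j i.
Proof. by have /matrixP/(_ j i) := exch_skew s; rewrite !mxE. Qed.

Lemma exch_diag s i : exch s i i = 0.
Proof. by have := exch_skewE s i i; lia. Qed.

Lemma exchange_poly_homog s k : homog (coord k) 0 (exchange_poly s k).
Proof.
apply: homogD.
  have -> : 0 = coord k (pos_expo (exch s) k) by rewrite coord_expo exch_diag ltxx.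
  exact: homog_mon.
have -> : 0 = coord k (neg_expo (exch s) k) by rewrite coord_expo exch_diag ltxx.
exact: homog_mon.
Qed.

Lemma exchange_poly_neq0 s k i : exch s k i != 0 -> exchange_poly s k != 0.
Proof.
move=> b0; apply/eqP => p0.
have := coef0 ZP (pos_expo (exch s) k); rewrite -p0 coefD !coef_mon eqxx.
rewrite (_ : _ == pos_expo _ _ = false) ?addr0.
  by move/eqP; rewrite mulr1n (negbTE (grp_neq0 _)).
apply/negbTE/eqP => /(congr1 (coord i)); rewrite !coord_expo.
by move: b0; case: ifP; case: ifP; lia.
Qed.

(** The signs say that the matrix is cyclically oriented, with no zero off the
    diagonal; the equation makes this persist under mutation. *)
Definition markov B :=
  (forall i j l, i != j -> i != l -> j != l -> B i j * B i l < 0) /\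
  (forall i j l, i != j -> i != l -> j != l ->
     B i j ^+ 2 + B j l ^+ 2 + B i l ^+ 2 = `|B i j * B j l * B i l|).

(** The upper bound of Berenstein, Fomin and Zelevinsky. *)
Definition upper_bound s f :=
  laurent_ring (cluster s) f /\ forall k, laurent_ring (neighbour s k) f.

Lemma mutate_mx_third s k j l : j != k -> l != k -> j != l -> markov (exch s) ->
  mutate_mx k (exch s) j l = exch s j l + `|exch s j k| * exch s k l.
Proof.
move=> jk lk jl [sg _]; rewrite mxE (negbTE jk) (negbTE lk) /=; congr (_ + _).
have := sg k j l; rewrite ![k == _]eq_sym => /(_ jk lk jl).
have := exch_skewE s j k; move: (exch s j k) (exch s k j) (exch s k l) => a b c -> sbc.
have -> : - b * `|c| = `|- b| * c.
  have [b0|b0] := ltP 0 b.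
    have c0 : c < 0 by nia.
    by rewrite normrN (gtr0_norm b0) (ltr0_norm c0); lia.
  have c0 : 0 < c by nia.
  by rewrite normrN (gtr0_norm c0) ler0_norm.
by move: (`|- b| * c) => x; lia.
Qed.

Lemma three_cases i j l k : i != j -> i != l -> j != l -> [\/ k = i, k = j | k = l].
Proof.
move=> ij il jl; have: #|[set i; j; l]| = 3%N.
  by rewrite setUC cardsU1 cards2 !inE negb_or ij ![l == _]eq_sym il jl.
move=> c3; have: [set i; j; l] = setT by apply/eqP; rewrite eqEcard subsetT cardsT card_ord c3.
move/setP/(_ k); rewrite !inE -orbA => /or3P[]/eqP ->; by constructor.
Qed.

Lemma third_index j k : j != k -> exists l, l != j /\ l != k.
Proof.
move=> jk; have [l] : exists l, l \in ~: [set j; k].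
  by apply/card_gt0P; rewrite cardsCs setCK cards2 jk card_ord.
by rewrite !inE negb_or => /andP[? ?]; exists l.
Qed.

(** Vieta jumping. Mutation replaces |d| by |bc| - |d|, the other root of the
    quadratic equation. With signs, d d' = - (b^2 + c^2), so d' is nonzero and has
    the sign opposite to that of d. *)
Lemma markov_opposite s k j l : j != k -> l != k -> j != l -> markov (exch s) ->
  let b := exch s k j in let c := exch s k l in
  let d := mutate_mx k (exch s) j l in
  b * d < 0 /\ b ^+ 2 + d ^+ 2 + c ^+ 2 = `|b * d * c|.
Proof.
move=> jk lk jl ms; rewrite /= mutate_mx_third //; have [sg sq] := ms.
have := sg k j l; rewrite ![k == _]eq_sym => /(_ jk lk jl).
have := sg j k l; rewrite [k == l]eq_sym => /(_ jk jl lk).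
have := sq k j l; rewrite ![k == _]eq_sym => /(_ jk lk jl).
rewrite (exch_skewE s j k).
move: (exch s k j) (exch s k l) (exch s j l) => b c d.
have [b0|b0] := ltP 0 b => E1 E2 E3.
  have c0 : c < 0 by nia.
  have d0 : 0 < d by nia.
  have bd0 : 0 < b * d by exact: mulr_gt0.
  have nE : `|b * d * c| = - (b * d * c) by rewrite ltr0_norm //; nia.
  rewrite nE in E1; rewrite normrN (gtr0_norm b0).
  have dd0 : d * (d + b * c) < 0 by nia.
  have d'0 : d + b * c < 0 by nia.
  split; first by nia.
  have bd'0 : b * (d + b * c) < 0 by nia.
  by rewrite gtr0_norm; [move: E1; rewrite !expr2; lia|nia].
have b1 : b < 0 by nia.
have c0 : 0 < c by nia.
have d0 : d < 0 by nia.
have bd0 : 0 < b * d by nia.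
have nE : `|b * d * c| = b * d * c by rewrite gtr0_norm //; nia.
rewrite nE in E1; rewrite normrN (ltr0_norm b1).
have dd0 : d * (d + - b * c) < 0 by nia.
have d'0 : 0 < d + - b * c by nia.
split; first by nia.
have bd'0 : b * (d + - b * c) < 0 by nia.
by rewrite ltr0_norm; [move: E1; rewrite !expr2; lia|nia].
Qed.

Lemma markov_mutation k s t : mutation k s t -> markov (exch s) -> markov (exch t).
Proof.
case=> _ _ tE _ _ ms; have [sg sq] := ms; rewrite tE.
have Mk j : mutate_mx k (exch s) k j = - exch s k j by rewrite mxE eqxx.
have Mk' j : mutate_mx k (exch s) j k = exch s k j.
  by rewrite mxE eqxx orbT exch_skewE opprK.
have opp j l jk lk jl := @markov_opposite s k j l jk lk jl ms.
split=> i j l ij il jl; have ji : j != i by rewrite eq_sym.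
all: have li : l != i by rewrite eq_sym.
all: have lj : l != j by rewrite eq_sym.
all: have [E|E|E] := three_cases k ij il jl; subst k.
- by rewrite !Mk mulrNN; exact: sg.
- by rewrite Mk'; have [] := opp i l ij lj il.
- by rewrite Mk' mulrC; have [] := opp i j il jl ij.
- have [_ /= sqE] := opp j l ji li jl; rewrite !Mk sqrrN.
  by rewrite sqrrN sqE mulrN !mulNr opprK.
- have [_ /= sqE] := opp i l ij lj il; rewrite Mk Mk' sqrrN.
  by rewrite addrAC sqE mulrN mulNr normrN mulrAC.
have [_ /= sqE] := opp i j il jl ij; rewrite !Mk'.
by rewrite addrC addrA sqE -[in LHS]mulrA [in LHS]mulrC.
Qed.

(** The exchange polynomial in direction k has one term in the variable j and one
    in the third variable. Which of them comes first depends on the sign of the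
    entry (k, j); the next definitions name the coefficient of the term in the
    third variable, that of the term in the variable j, and the exponent of the
    former. *)
Definition coef_other s k j := if 0 < exch s k j then coefm s k else coefp s k.
Definition coef_towards s k j := if 0 < exch s k j then coefp s k else coefm s k.
Definition expo_other s k j :=
  if 0 < exch s k j then neg_expo (exch s) k else pos_expo (exch s) k.

Lemma expo_other_third s k j : third k j (expo_other s k j).
Proof.
rewrite /expo_other; case: (ltP 0 (exch s k j)) => b0; split;
  by rewrite coord_expo ?exch_diag ?ltxx // ifF //; lia.
Qed.

Section Row.
Variables (s : seed P) (k j l : 'I_3).
Hypotheses (lj : l != j) (lk : l != k) (jk : j != k) (ms : markov (exch s)).

Lemma opposite_signs : exch s k j * exch s k l < 0.
Proof. by have [sg _] := ms; apply: sg; rewrite // eq_sym. Qed.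

Lemma exchange_poly_row : exchange_poly s k =
  bin_last j (grp (coef_other s k j)) (grp (coef_towards s k j)) (expo_other s k j) `|exch s k j|%N.
Proof.
have opp := opposite_signs.
rewrite /exchange_poly /bin_last /coef_other /coef_towards /expo_other.
case: (ltP 0 (exch s k j)) => b0; last congr (_ + mon _ _); first rewrite addrC; first congr (_ + mon _ _);
  apply: expoP => m; rewrite coordMn coord_unit coord_expo; have [->|->|->] := three_cases m lj lk jk;
  rewrite ?exch_diag ?ltxx ?(negbTE jk) ?eqxx ?[j == l]eq_sym ?(negbTE lj) ?mul0rn ?natz //.
- by rewrite ifF //; apply/negbTE; rewrite -leNgt; nia.
- by rewrite b0 gez0_abs // ltW.
- by rewrite ifF //; apply/negbTE; rewrite -leNgt; nia.
rewrite ifT; first by rewrite lez0_abs.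
by rewrite lt_neqAle b0 andbT; apply: contraTneq opp => ->; rewrite mul0r ltxx.
Qed.

Lemma coord_expo_other : coord l (expo_other s k j) = `|exch s k l|.
Proof.
have opp := opposite_signs; rewrite /expo_other.
case: (ltP 0 (exch s k j)) => b0; rewrite coord_expo ifT; nia.
Qed.

End Row.

Lemma third_sym i j (k : Z3) : third i j k -> third j i k.
Proof. by case. Qed.

Lemma third_expoP i j l (k k' : Z3) : l != j -> l != i -> j != i -> third i j k -> third i j k' ->
  coord l k = coord l k' -> k = k'.
Proof.
move=> lj li ji [ki kj] [ki' kj'] kl; apply: expoP => m.
by have [->|->|->] := three_cases m lj li ji; rewrite ?ki ?kj ?ki' ?kj'.
Qed.

(** The mutation at k followed by the one at j, in the situation of
    [corner_two_step]. The relations between exponents and coefficients needed there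
    are the mutation rules for the matrix and for the ratios of coefficients. *)
Lemma upper_bound_step_neq k s t f j : mutation k s t -> markov (exch s) ->
  upper_bound s f -> j != k -> laurent_ring (neighbour t j) f.
Proof.
move=> mut ms [fs fn] jk; have mt := markov_mutation mut ms.
have [l [lj lk]] := third_index jk.
have tE := mutation_cluster mut; case: (mut) => _ _ exE [pE mE] ratio.
have kj : k != j by rewrite eq_sym.
have tjk : exch t j k = exch s k j by rewrite exE mxE eqxx orbT (exch_skewE s j k) opprK.
have bjk := exch_skewE s j k.
have tjl : exch t j l = exch s j l + `|exch s j k| * exch s k l.
  by rewrite exE mutate_mx_third // eq_sym.
have opp := opposite_signs lj lk jk ms.
have opp_s := opposite_signs lk lj kj ms.
have opp_t := opposite_signs lk lj kj mt.
have nz : exch s k j != 0 by apply: contraTneq opp => ->; rewrite mul0r ltxx.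
have tj0 : exchange_poly t j != 0 by apply: (exchange_poly_neq0 (i := k)); rewrite tjk.
have zj0 m : neighbour t j m != 0.
  exact: exchanged_neq0 (seed_neq0 t) (@seed_inj t) tj0 m.
have yj : cluster t j = cluster s j.
  by rewrite tE /neighbour /exchanged (negbTE jk).
have yk : neighbour t j k = neighbour s k k.
  by rewrite /neighbour {1}/exchanged (negbTE kj) tE.
have ym m : m != k -> m != j -> neighbour t j m = cluster s m.
  move=> mk mj; rewrite /neighbour /exchanged (negbTE mj) tE.
  by rewrite /neighbour /exchanged (negbTE mk).
have yzj : cluster s j * neighbour t j j = evr (cluster t) (exchange_poly t j).
  by rewrite -yj /neighbour /exchanged eqxx mulrC (divfK (seed_neq0 t j)).
set b := `|exch s k j|%N; have b0 : (0 < b)%N by rewrite absz_gt0.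
have row_k := exchange_poly_row lj lk jk ms.
have row_j := exchange_poly_row lk lj kj ms; rewrite bjk abszN -/b in row_j.
have row_t := exchange_poly_row lk lj kj mt; rewrite tjk -/b in row_t.
have u3 := expo_other_third s k j.
have v3 := third_sym (expo_other_third s j k).
have v'3 := third_sym (expo_other_third t j k).
rewrite -bin_first_last in row_j; rewrite -bin_first_last in row_t.
have := fn k; have := fn j; rewrite /neighbour row_k row_j => fj fk.
have [g gW ->] := laurent_to_corner (cluster_free s) kj b0 u3 v3 fs fk fj.
have zk : neighbour t j k = evr (cluster s) (bin_last j (grp (coef_other s k j))
    (grp (coef_towards s k j)) (expo_other s k j) b) / cluster s k.
  by rewrite yk /neighbour /exchanged eqxx row_k.
have yzj' : cluster s j * neighbour t j j =
    of_coef (coef_other t j k) * monev (cluster s) (expo_other t j k) +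
    of_coef (coef_towards t j k) * neighbour t j k ^+ b.
  have m_ts : monev (cluster t) (expo_other t j k) = monev (cluster s) (expo_other t j k).
    apply: (monev_third (i := k) (j := j)) v'3 => m mk mj.
    by rewrite tE /neighbour /exchanged (negbTE mk).
  have E := ev_bin_first k (coef_other t j k) (coef_towards t j k) (expo_other t j k) b (cluster_free t).
  rewrite yzj row_t E m_ts (tE k) -yk; exact: addrC.
have vv' : expo_other s j k + expo_other t j k = expo_other s k j *+ b.
  have uv : third k j (expo_other s j k + expo_other t j k).
    by case: v3 v'3 => a1 a2 [a3 a4]; split; rewrite coordD ?a1 ?a2 ?a3 ?a4.
  have u3b : third k j (expo_other s k j *+ b).
    by case: u3 => a1 a2; split; rewrite coordMn ?a1 ?a2 mul0rn.
  apply: (third_expoP lj lk jk uv u3b).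
  rewrite coordD coordMn (coord_expo_other lk lj kj ms) (coord_expo_other lk lj kj mt).
  rewrite (coord_expo_other lj lk jk ms) tjl bjk normrN.
  rewrite -mulr_natr natz /b abszE.
  move: opp_t opp_s opp; rewrite tjl tjk bjk normrN.
  move: (exch s k j) (exch s k l) (exch s j l) => x c d.
  have [x0|x0] := ltP 0 x => E1 E2 E3.
    rewrite (gtr0_norm x0) in E1 *.
    have c0 : c < 0 by nia.
    have d0 : 0 < d by nia.
    have d'0 : d + x * c < 0 by nia.
    by rewrite (ltr0_norm c0) (gtr0_norm d0) (ltr0_norm d'0); lia.
  have x1 : x < 0 by nia.
  rewrite (ltr0_norm x1) in E1 *.
  have c0 : 0 < c by nia.
  have d0 : d < 0 by nia.
  have d'0 : 0 < d + - x * c by nia.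
  by rewrite (gtr0_norm c0) (ltr0_norm d0) (gtr0_norm d'0); lia.
suff coefs : coef_other s j k + coef_other t j k =
    coef_towards s j k + coef_towards t j k + coef_other s k j *+ b.
  exact: (corner_two_step (cluster_free s) b0 u3 ym zk (zj0 k) (zj0 j) yzj' v'3 vv' coefs gW).
rewrite /coef_other /coef_towards tjk; have := ratio j jk; rewrite bjk !oppr_gt0 oppr_ge0.
have [x0|x0] := ltP 0 (exch s k j).
  rewrite (lt_gtF x0) => /(canRL (subrK _)) ->.
  rewrite mulrNz -{1}(gtz0_abs x0) -/b -pmulrn.
  rewrite -(addrA (- _)) [_ + (- _ + _)]addrCA [RHS]addrAC addNr add0r.
  by rewrite addrA [_ + (_ - _)]addrC subrK.
have x1 : exch s k j < 0 by rewrite lt_neqAle nz.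
rewrite x1 => /(canRL (subrK _)) ->.
rewrite -(lez0_abs x0) -/b -pmulrn.
by rewrite [LHS]addrC -!addrA (addrC (coefm t j)) addKr [LHS]addrC -addrA.
Qed.

End Seeds.

(** * The upper bound and the upper cluster algebra *)

Section UpperBound.
Variable P : torsionFreeZmodType.
Local Notation ZP := (group_ring int P).
Local Notation K := (base_field P).
Local Notation F := (ambient P).
Local Notation evr := (ev (@of_ring P)).
Implicit Types (y z : 'I_3 -> F) (f : F) (s t : seed P) (i j k l : 'I_3).

Lemma monev_free y z j (e : Z3) : (forall i, i != j -> y i = z i) -> coord j e = 0 ->
  monev y e = monev z e.
Proof.
move=> yz ej; rewrite !monevE; apply: eq_bigr => i _.
by have [->|/yz->//] := eqVneq i j; rewrite ej !expr0z.
Qed.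

Lemma ev_exchange_poly_free s k y z : (forall i, i != k -> y i = z i) ->
  evr y (exchange_poly s k) = evr z (exchange_poly s k).
Proof.
move=> yz; rewrite !evD !ev_mon.
have -> : monev y (pos_expo (exch s) k) = monev z (pos_expo (exch s) k).
  by apply: monev_free yz _; rewrite coord_expo exch_diag ltxx.
suff -> : monev y (neg_expo (exch s) k) = monev z (neg_expo (exch s) k) by [].
by apply: monev_free yz _; rewrite coord_expo exch_diag ltxx.
Qed.

Lemma exchange_poly_mutation k s t : mutation k s t -> exchange_poly t k = exchange_poly s k.
Proof.
case=> _ _ tE [pE mE] _; rewrite /exchange_poly pE mE addrC.
have kE i : exch t k i = - exch s k i by rewrite tE mxE eqxx.
have -> : neg_expo (exch t) k = pos_expo (exch s) k.
  by apply: expoP => i; rewrite !coord_expo kE opprK oppr_lt0.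
suff -> : pos_expo (exch t) k = neg_expo (exch s) k by [].
by apply: expoP => i; rewrite !coord_expo kE oppr_gt0.
Qed.

Lemma ev_neighbour_exchange_poly s k :
  evr (neighbour s k) (exchange_poly s k) = evr (cluster s) (exchange_poly s k).
Proof.
by apply: ev_exchange_poly_free => l lk; rewrite /neighbour /exchanged (negbTE lk).
Qed.

Lemma cluster_of_neighbour s k : exchange_poly s k != 0 ->
  cluster s k = evr (neighbour s k) (exchange_poly s k) / neighbour s k k.
Proof.
move=> p0; rewrite ev_neighbour_exchange_poly /neighbour /exchanged eqxx invf_div mulrC divfK //.
exact: ev_neq0 (@seed_inj _ s) p0.
Qed.

Lemma neighbour_back k s t : mutation k s t -> exchange_poly s k != 0 ->
  forall i, neighbour t k i = cluster s i.
Proof.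
move=> mut p0 i; have E := mutation_cluster mut.
have [->|ik] := eqVneq i k; last first.
  by rewrite /neighbour /exchanged (negbTE ik) E /neighbour /exchanged (negbTE ik).
rewrite (cluster_of_neighbour p0) -(eq_ev _ _ E) -E.
by rewrite {1}/neighbour /exchanged eqxx (exchange_poly_mutation mut).
Qed.

Lemma markov_row_neq0 s k : markov (exch s) -> exists i, exch s k i != 0.
Proof.
have [j jk] : exists j, j != k.
  by have /card_gt0P[j] : (0 < #|[set~ k]|)%N;
    [rewrite cardsC1 card_ord|rewrite !inE; exists j].
have [l [lj lk]] := third_index jk => ms; exists j.
by have := opposite_signs lj lk jk ms; apply: contraTneq => ->; rewrite mul0r ltxx.
Qed.

Lemma upper_bound_step k s t f : mutation k s t -> markov (exch s) ->
  upper_bound s f -> upper_bound t f.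
Proof.
move=> mut ms fs; split.
  by apply: laurent_ring_eq (fs.2 k) => i; rewrite (mutation_cluster mut).
move=> j; have [->|jk] := eqVneq j k; last exact: upper_bound_step_neq mut ms fs jk.
have [i ki0] := markov_row_neq0 k ms.
apply: laurent_ring_eq fs.1 => m.
by rewrite (neighbour_back mut (exchange_poly_neq0 ki0)).
Qed.

(** The upper bound is preserved by mutation, and it is contained in the Laurent
    ring of its own cluster. *)
Lemma upper_bound_sub s f : markov (exch s) -> upper_bound s f -> upper_cluster_algebra s f.
Proof.
move=> ms fs t st; suff [_ []] : markov (exch t) /\ upper_bound t f by [].
elim: st ms fs => {s t} [s t [k mut]|s|s r t _ IH1 _ IH2] ms fs //.
  by split; [exact: markov_mutation mut ms|exact: upper_bound_step mut ms fs].
by have [mr fr] := IH1 ms fs; exact: IH2.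
Qed.

Lemma field_gen_sub (S T : F -> Prop) f :
  (forall g, S g -> field_gen T g) -> field_gen S f -> field_gen T f.
Proof.
move=> ST; elim=> [a|g /ST//|g h _ ? _ ?|g h _ ? _ ?|g _ ?].
- exact: field_gen_base.
- exact: field_gen_add.
- exact: field_gen_mul.
exact: field_gen_inv.
Qed.

Lemma field_gen1 (S : F -> Prop) : field_gen S 1.
Proof. by rewrite -(rmorph1 (@of_base P)); exact: field_gen_base. Qed.

Lemma field_gen_monev y (S : F -> Prop) (e : Z3) :
  (forall i, S (y i)) -> field_gen S (monev y e).
Proof.
move=> Sy; rewrite monevE; apply: big_ind; first exact: field_gen1.
  by move=> *; exact: field_gen_mul.
have SX i (n : nat) : field_gen S (y i ^+ n).
  elim: n => [|n IH]; first exact: field_gen1.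
  by rewrite exprS; apply: field_gen_mul => //; exact: field_gen_in.
move=> i _; case: (coord i e) => n; first exact: SX.
by rewrite NegzE -invr_expz; apply: field_gen_inv; exact: SX.
Qed.

(** Algebraic independence is [exchanged_inj] over the base field, and the old
    variable is recovered from the exchange relation. *)
Lemma neighbour_free s k i : exch s k i != 0 -> freely_generates (neighbour s k).
Proof.
move=> ki0; have [_ sgen] := cluster_free s.
have p0 := exchange_poly_neq0 ki0.
split=> [q|f].
  apply: ev_inj_free.
  pose pK : laurent K := mon (tofrac (grp (coefp s k))) (pos_expo (exch s) k) +
    mon (tofrac (grp (coefm s k))) (neg_expo (exch s) k).
  have pKE y : ev (@of_base P) y pK = evr y (exchange_poly s k).
    by rewrite !evD !ev_mon.
  have nE m : neighbour s k m = exchanged (@of_base P) (cluster s) k pK m.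
    by rewrite /neighbour /exchanged pKE.
  have hom : homog (coord k) 0 pK.
    apply: homogD.
      have -> : 0 = coord k (pos_expo (exch s) k) by rewrite coord_expo exch_diag ltxx.
      exact: homog_mon.
    have -> : 0 = coord k (neg_expo (exch s) k) by rewrite coord_expo exch_diag ltxx.
    exact: homog_mon.
  have pK0 : pK != 0.
    apply: contra_neq (ev_neq0 (@seed_inj _ s) p0) => pK0.
    by rewrite -pKE pK0 ev0.
  move=> g g0; apply: (exchanged_inj (seed_neq0 s) (of_base_ev_inj (cluster_free s)) pK0 hom).
  by rewrite -(eq_ev _ _ nE).
apply: field_gen_sub (sgen f) => _ [m ->].
have gen_n l : field_gen (fun g => exists i, g = neighbour s k i) (neighbour s k l).
  by apply: field_gen_in; exists l.
have [->|mk] := eqVneq m k; last first.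
  by have := gen_n m; rewrite {2}/neighbour /exchanged (negbTE mk).
rewrite (cluster_of_neighbour p0).
apply: field_gen_mul; last exact: field_gen_inv.
rewrite evD !ev_mon; apply: field_gen_add; apply: field_gen_mul;
  try exact: field_gen_base; by apply: field_gen_monev => l; exists l.
Qed.

(** The coefficients in the directions other than k may be normalized by taking
    the negative ones trivial. *)
Lemma mutation_exists s k i : exch s k i != 0 ->
  (mutate_mx k (exch s))^T = - mutate_mx k (exch s) -> exists t, mutation k s t.
Proof.
move=> ki0 sk.
pose r j := (if 0 <= exch s j k then coefp s k else coefm s k) *~ exch s j k +
  (coefp s j - coefm s j).
exists (Seed (fun j => if j == k then coefm s k else r j)
  (fun j => if j == k then coefp s k else 0) (neighbour_free ki0) sk).
split=> //= [j jk||| j jk].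
- by rewrite /neighbour /exchanged (negbTE jk).
- rewrite /neighbour /exchanged eqxx mulrC divfK ?seed_neq0 //.
  exact: ev_exchange_poly.
- by rewrite eqxx.
by rewrite (negbTE jk) subr0.
Qed.

Lemma upper_cluster_bound s f :
  (forall k, exists t, mutation k s t) -> upper_cluster_algebra s f -> upper_bound s f.
Proof.
move=> ex fU; split; first exact/fU/rt_refl.
move=> k; have [t mut] := ex k.
have := fU t (rt_step _ _ _ _ (ex_intro _ k mut)).
by apply: laurent_ring_eq => i; rewrite (mutation_cluster mut).
Qed.

End UpperBound.

Lemma markov_exch3 : markov exch3.
Proof.
by split; move=> [[|[|[|//]]] i3] [[|[|[|//]]] j3] [[|[|[|//]]] l3] //; rewrite !mxE.
Qed.

Lemma mutate_exch3_skew k : (mutate_mx k exch3)^T = - mutate_mx k exch3.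
Proof.
apply/matrixP => i j; rewrite !mxE; move: k i j.
by move=> [[|[|[|//]]] i3] [[|[|[|//]]] j3] [[|[|[|//]]] l3].
Qed.

(** * Degrees at most zero *)

Definition nx (i : 'I_3) : 'I_3 := ordS i.

Lemma nx_neq i : nx i != i.
Proof. by case: i => [[|[|[|//]]] i3]. Qed.
Lemma nxx_neq i : nx (nx i) != i.
Proof. by case: i => [[|[|[|//]]] i3]. Qed.
Lemma nx3 i : nx (nx (nx i)) = i.
Proof. by apply: val_inj; case: i => [[|[|[|//]]] i3]. Qed.
Lemma nx_inj : injective nx.
Proof. exact: (can_inj (g := fun i => nx (nx i)) nx3). Qed.

Lemma nx_cases i m : [\/ m = i, m = nx i | m = nx (nx i)].
Proof.
by apply: three_cases; rewrite eq_sym ?nx_neq ?nxx_neq.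
Qed.

Lemma deg_nx i k : deg k = coord i k + coord (nx i) k + coord (nx (nx i)) k.
Proof.
rewrite /deg (bigD1 i) //= (bigD1 (nx i)) ?nx_neq //= (bigD1 (nx (nx i))) /=; last first.
  by rewrite nxx_neq nx_neq.
rewrite big1 ?addr0 ?addrA // => m /andP[/andP[mi mn] mnn].
by case: (nx_cases i m) mi mn mnn => -> ; rewrite ?eqxx.
Qed.

Lemma deg_unit i : deg (unit_expo i) = 1.
Proof.
by rewrite (deg_nx i) !coord_unit eqxx ![i == _]eq_sym (negbTE (nx_neq i)) (negbTE (nxx_neq i)).
Qed.

Lemma slice_comm (R : idomainType) (lam mu : {additive Z3 -> int}) v w (g : laurent R) :
  slice lam v (slice mu w g) = slice mu w (slice lam v g).
Proof. by apply: coefP => k; rewrite !coef_slice; case: ifP; case: ifP. Qed.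

Section Degree.
Variables (R : idomainType) (al be : 'I_3 -> R).
Hypotheses (al0 : forall i, al i != 0) (be0 : forall i, be i != 0).
Hypothesis nontorsion : forall n, (0 < n)%N -> \prod_i al i ^+ n != \prod_i be i ^+ n.
Implicit Types (g h : laurent R) (i : 'I_3) (d : int).

(** The exchange polynomials of the initial seed. *)
Definition cubic i : laurent R :=
  mon (al i) (unit_expo (nx i) *+ 3) + mon (be i) (unit_expo (nx (nx i)) *+ 3).

Definition admissible g := forall i, slices_divisible i (cubic i) g.

Lemma cubic_deg i : homog deg 3 (cubic i).
Proof.
apply: homogD.
  have -> : 3 = deg (unit_expo (nx i) *+ 3) by rewrite raddfMn /= deg_unit.
  exact: homog_mon.
have -> : 3 = deg (unit_expo (nx (nx i)) *+ 3) by rewrite raddfMn /= deg_unit.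
exact: homog_mon.
Qed.

Lemma admissible_slice g d : admissible g -> admissible (slice deg d g).
Proof.
move=> ga i n; have [h hE] := ga i n; exists (slice deg (d - 3 *+ n) h).
by rewrite slice_comm hE (homogX _ (@cubic_deg i)).
Qed.

(** A vertex of the triangle of exponents of degree 0 with all coordinates at least
    [- n]. *)
Definition vertex i (n : nat) : Z3 := expo (fun j => - n%:Z + (if j == i then 3 * n%:Z else 0)).

(** The coefficient of x_i^{-n} is p_i^n h with h nonzero. It spreads over at least
    3n + 1 exponents along the row, and the row has only 3n + d + 1 places; so d = 0,
    h is a monomial, and both vertices on this side occur in g. *)
Lemma extremal_row g i d n : (0 < n)%N -> d <= 0 -> slice (coord i) (- n%:Z) g != 0 ->
  admissible g -> (forall k, coef g k != 0 -> deg k = d) ->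
  (forall k j, coef g k != 0 -> - n%:Z <= coord j k) ->
  d = 0 /\ exists2 c, c != 0 & coef g (vertex (nx i) n) = al i ^+ n * c /\
     coef g (vertex (nx (nx i)) n) = be i ^+ n * c.
Proof.
move=> n0 d0 gi0 ga gd gn; have [h hE] := ga i n.
have h0 : h != 0 by apply: contraNneq gi0 => h0; rewrite hE h0 mulr0.
have uv : coord (nx i) (unit_expo (nx (nx i)) *+ 3) < coord (nx i) (unit_expo (nx i) *+ 3).
  by rewrite !coordMn !coord_unit eqxx (negbTE (nx_neq _)).
have [k [l [lk Ek El hk hl]]] :=
  binomial_spread (lam := coord (nx i)) n (al0 i) (be0 i) uv h0.
move: Ek El; rewrite -/(cubic i) -hE !coef_slice.
set K := k + _; set L := l + _.
case: eqP => [Ki EK|_ E]; last first.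
  by move/esym/eqP: E; rewrite mulf_eq0 expf_eq0 (negbTE (al0 i)) andbF (negbTE hk).
case: eqP => [Li EL|_ E]; last first.
  by move/esym/eqP: E; rewrite mulf_eq0 expf_eq0 (negbTE (be0 i)) andbF (negbTE hl).
have K0 : coef g K != 0 by rewrite EK mulf_neq0 ?expf_neq0.
have L0 : coef g L != 0 by rewrite EL mulf_neq0 ?expf_neq0.
have := gd K K0; have := gd L L0; rewrite !(deg_nx i) Ki Li.
have := gn K (nx (nx i)) K0; have := gn L (nx i) L0; move: Ki Li lk.
rewrite /= /K /L !coordD !coordMn !coord_unit !eqxx.
rewrite (negbTE (nx_neq i)) (negbTE (nxx_neq i)) (negbTE (nx_neq (nx i))) [nx i == _]eq_sym.
rewrite (negbTE (nx_neq (nx i))) !mul0rn !addr0 => Ki Li lk L1 K2 Ld Kd.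
have d_eq : d = 0 by move: Ld Kd; rewrite !natz; lia.
split=> //; exists (coef h k) => //.
have kE : k = expo (fun=> - n%:Z).
  apply: expoP => m; rewrite coord_expo.
  have [->|->|->] := nx_cases i m => //; move: Ld Kd; rewrite !natz; lia.
have lE : l = expo (fun=> - n%:Z).
  apply: expoP => m; rewrite coord_expo.
  have [->|->|->] := nx_cases i m => //; move: Ld Kd; rewrite !natz; lia.
have vE m : vertex m n = expo (fun=> - n%:Z) + unit_expo m *+ 3 *+ n.
  apply: expoP => j; rewrite coordD !coordMn !coord_expo eq_sym.
  by case: (m == j); rewrite ?mul0rn ?addr0 //; lia.
rewrite !vE; split; first by rewrite -kE.
by rewrite -lE EL lE kE.
Qed.

(** Let n be the order of the worst pole. If n > 0, a side with a pole of order n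
    has both its vertices in g by [extremal_row], hence so do the other two sides,
    and each side gives a factor c_i. Multiplying, over the sides, the values at
    their two ends contradicts the hypothesis on the coefficients. *)
Lemma nonpositive_degree g d : admissible g -> (forall k, coef g k != 0 -> deg k = d) ->
  d <= 0 -> forall k, coef g k != 0 -> k = 0.
Proof.
move=> ga gd d0 k gk.
pose bounded (n : nat) := all (fun l => [forall j, - n%:Z <= coord j l]) (supp g).
have : exists n, bounded n.
  have [N gN] := coord_bound g; exists N; apply/allP => l ls; apply/forallP => j.
  by have := gN l j ls; lia.
move=> exn; have [n /allP nb nmin] := ex_minnP exn.
have gn l j : coef g l != 0 -> - n%:Z <= coord j l.
  by rewrite -supp_neq0 => /nb/forallP.
have [n0|n0] := posnP n.
  apply: expoP => j; rewrite raddf0.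
  have := gd k gk; rewrite (deg_nx j).
  by have := gn k j gk; have := gn k (nx j) gk; have := gn k (nx (nx j)) gk; rewrite n0; lia.
have [l [i [gl li]]] : exists l i, coef g l != 0 /\ coord i l = - n%:Z.
  have /allPn[l ls /forallPn[i li]] : ~~ bounded n.-1.
    by apply/negP => /nmin; rewrite leqNgt ltn_predL n0.
  exists l, i; rewrite -supp_neq0; split=> //.
  by have := gn l i; rewrite -supp_neq0 => /(_ ls); move: li; lia.
have slice_neq0 m j : coef g m != 0 -> coord j m = - n%:Z ->
    slice (coord j) (- n%:Z) g != 0.
  move=> gm jm; apply: contraNneq gm => s0.
  by have := coef_slice (coord j) (- n%:Z) g m; rewrite s0 coef0 /= jm eqxx => <-.
have row j : slice (coord j) (- n%:Z) g != 0 -> exists2 c, c != 0 &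
    coef g (vertex (nx j) n) = al j ^+ n * c /\
    coef g (vertex (nx (nx j)) n) = be j ^+ n * c.
  by move=> /(extremal_row n0 d0)/(_ ga gd gn)[].
have vertex_coord a b : a != b -> coord a (vertex b n) = - n%:Z.
  by move=> ab; rewrite coord_expo (negbTE ab) addr0.
have all_rows j : exists2 c, c != 0 &
    coef g (vertex (nx j) n) = al j ^+ n * c /\
    coef g (vertex (nx (nx j)) n) = be j ^+ n * c.
  have [c c0 [c1 c2]] := row i (slice_neq0 l i gl li).
  have [->|->|->] := nx_cases i j; apply: row.
  - exact: slice_neq0 gl li.
  - apply: slice_neq0 (vertex_coord _ (nx (nx i)) _).
      by rewrite c2 mulf_neq0 ?expf_neq0.
    by rewrite eq_sym nx_neq.
  apply: slice_neq0 (vertex_coord _ (nx i) (nx_neq _)).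
  by rewrite c1 mulf_neq0 ?expf_neq0.
have /fin_all_exists[c cP] : forall j, exists c, c != 0 /\
    coef g (vertex (nx j) n) = al j ^+ n * c /\
    coef g (vertex (nx (nx j)) n) = be j ^+ n * c.
  by move=> j; have [c c0 cE] := all_rows j; exists c.
have c0 : \prod_j c j != 0 by apply/prodf_neq0 => j _; case: (cP j).
have := nontorsion n0; rewrite -(inj_eq (mulIf c0)) -!big_split /=.
have -> : \prod_j (al j ^+ n * c j) = \prod_j coef g (vertex j n).
  by rewrite [RHS](reindex_inj nx_inj); apply: eq_bigr => j _; case: (cP j) => _ [-> _].
suff -> : \prod_j (be j ^+ n * c j) = \prod_j coef g (vertex j n) by rewrite eqxx.
rewrite [RHS](reindex_inj (inj_comp nx_inj nx_inj)).
by apply: eq_bigr => j _; case: (cP j) => _ [_ /= ->].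
Qed.

End Degree.

(** * Linear systems over a domain *)

Section Kernel.
Variable R : idomainType.

Lemma fraction_clear (f : {fraction R}) :
  exists n d : R, d != 0 /\ f * tofrac d = tofrac n.
Proof.
have [n [d ->]] := fractionE f; have [->|d0] := eqVneq d 0.
  by exists 0, 1; rewrite oner_neq0 tofrac0 invr0 mulr0 mul0r.
by exists n, d; rewrite divfK // tofrac_eq0.
Qed.

Lemma common_denominator (I : finType) (w : I -> {fraction R}) :
  exists (v : I -> R) (d : R), d != 0 /\ forall i, w i * tofrac d = tofrac (v i).
Proof.
have /fin_all_exists2[n _ nP] : forall i, exists2 n : R, True & exists d, d != 0 /\ w i * tofrac d = tofrac n.
  by move=> i; have [n [d dP]] := fraction_clear (w i); exists n => //; exists d.
have [d dP] := fin_all_exists nP.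
exists (fun i => n i * \prod_(j | j != i) d j), (\prod_j d j).
split; first by apply/prodf_neq0 => j _; case: (dP j).
move=> i; rewrite (bigD1 i) //= !tofracM mulrA; case: (dP i) => _ ->.
by [].
Qed.

(** Solve over the field of fractions and clear denominators. *)
Lemma more_unknowns (I J : finType) (phi : I -> J -> R) : (#|J| < #|I|)%N ->
  exists v : I -> R, (exists i, v i != 0) /\ forall j, \sum_i v i * phi i j = 0.
Proof.
move=> JI.
pose M : 'M[{fraction R}]_(#|I|, #|J|) :=
  \matrix_(a, b) tofrac (phi (enum_val a) (enum_val b)).
have kM : (0 < \rank (kermx M))%N.
  by rewrite mxrank_ker subn_gt0; apply: leq_ltn_trans (rank_leq_col M) JI.
have [a ka] : exists a, row a (kermx M) != 0.
  apply/existsP; apply: contraTT kM; rewrite negb_exists => /forallP k0.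
  suff -> : kermx M = 0 by rewrite mxrank0.
  by apply/row_matrixP => a; rewrite row0; apply/eqP; have := k0 a; rewrite negbK.
set w := row a _ in ka.
have wM : w *m M = 0 by rewrite /w -row_mul mulmx_ker row0.
have [v [d [d0 vE]]] := common_denominator (fun i : I => w 0 (enum_rank i)).
exists v; split.
  have [b wb] : exists b, w 0 b != 0.
    apply/existsP; apply: contraNT ka; rewrite negb_exists => /forallP k0.
    by apply/eqP/rowP => b; rewrite [RHS]mxE; apply/eqP; have := k0 b; rewrite negbK.
  exists (enum_val b); rewrite -tofrac_eq0 -vE enum_valK mulf_neq0 //.
  by rewrite tofrac_eq0.
move=> j; apply/eqP; rewrite -tofrac_eq0 rmorph_sum /=; apply/eqP.
have /rowP/(_ (enum_rank j)) := wM; rewrite mxE [RHS]mxE => E.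
rewrite -[RHS](mul0r (tofrac d)) -[in RHS]E mulr_suml (reindex _ (onW_bij _ (enum_val_bij I))) /=.
apply: eq_bigr => b _; by rewrite tofracM -vE enum_valK [M _ _]mxE enum_rankK; ring.
Qed.

End Kernel.

(** * Elements of degree one with poles of large order *)

Lemma regroup (V : comNzRingType) (a a' b q c : V) m : a * a' = 1 ->
  b * (q * c ^+ m) = (a * c) ^+ m * (a' ^+ m * b * q).
Proof.
move=> aa'; transitivity ((a * a') ^+ m * (b * q * c ^+ m)).
  by rewrite aa' expr1n mul1r mulrA.
by rewrite !exprMn; ring.
Qed.

Section Rows.
Variables (R : idomainType) (al be : 'I_3 -> R).
Hypothesis al_unit : forall i, al i \is a GRing.unit.
Implicit Types (f g h : laurent R) (i : 'I_3) (n m : nat).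

Definition cst (c : R) : laurent R := mon c 0.
Lemma cst_is_zmod_morphism : zmod_morphism cst.
Proof. by move=> c d; rewrite /cst monB. Qed.
Lemma cst_is_monoid_morphism : monoid_morphism cst.
Proof. by split=> [|c d]; rewrite /cst ?mon1 // monM addr0. Qed.
HB.instance Definition _ :=
  GRing.isZmodMorphism.Build R (laurent R) cst cst_is_zmod_morphism.
HB.instance Definition _ :=
  GRing.isMonoidMorphism.Build R (laurent R) cst cst_is_monoid_morphism.

Definition edge i : Z3 := unit_expo (nx i) - unit_expo (nx (nx i)).
(** Along the row of exponents where the coordinate i and the degree are fixed, a
    Laurent polynomial is a monomial times a polynomial in x_{i+1} / x_{i+2}. *)
Definition homogenize i (r : {poly R}) : laurent R := (map_poly cst r).[mon 1 (edge i)].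

Lemma homogenizeM i r s : homogenize i (r * s) = homogenize i r * homogenize i s.
Proof. by rewrite /homogenize rmorphM hornerM. Qed.

Lemma homogenizeX i r n : homogenize i (r ^+ n) = homogenize i r ^+ n.
Proof. by rewrite /homogenize rmorphXn horner_exp. Qed.

Lemma homogenize_poly i n (E : nat -> R) :
  homogenize i (\poly_(j < n) E j) = \sum_(j < n) mon (E j) (edge i *+ j).
Proof.
rewrite /homogenize poly_def raddf_sum horner_sum; apply: eq_bigr => j _ /=.
by rewrite map_polyZ hornerZ map_polyXn hornerXn monX expr1n monM mulr1 add0r.
Qed.

Definition cubic_poly i : {poly R} := 'X^3 + (be i / al i)%:P.

Lemma cubicE i : cubic al be i =
  mon (al i) (unit_expo (nx (nx i)) *+ 3) * homogenize i (cubic_poly i).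
Proof.
rewrite /homogenize /cubic_poly raddfD /= map_polyXn map_polyC hornerD hornerXn hornerC.
rewrite monX expr1n mulrDr !monM mulr1 mulrCA (divrr (al_unit i)) mulr1 addr0.
by rewrite /edge mulrnBl [_ + (_ - _)]addrC subrK.
Qed.

(** The first exponent of the row where the coordinate i is [- m], the degree is 1
    and the next coordinate is at least [- n]. *)
Definition row_base i m n : Z3 :=
  expo (fun a => if a == i then - m%:Z else if a == nx i then - n%:Z else 1 + m%:Z + n%:Z).
Definition row_key i m n j : Z3 := row_base i m n + edge i *+ j.
Definition row_poly i m n f : {poly R} :=
  \poly_(j < n + n + m + 2) coef f (row_key i m n j).

Definition degree_one n f := forall k, coef f k != 0 ->
  deg k = 1 /\ forall i, - n%:Z <= coord i k.

Lemma coord_row_key i m n j : [/\ coord i (row_key i m n j) = - m%:Z,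
  coord (nx i) (row_key i m n j) = j%:Z - n%:Z &
  coord (nx (nx i)) (row_key i m n j) = 1 + m%:Z + n%:Z - j%:Z].
Proof.
rewrite /row_key /edge !coordD !coordMn !coordB !coord_unit !coord_expo !eqxx.
rewrite (negbTE (nx_neq i)) (negbTE (nxx_neq i)) (negbTE (nx_neq (nx i))) [nx i == nx _]eq_sym.
rewrite (negbTE (nx_neq (nx i))) mul0rn addr0 subr0 sub0r !mulNrn !natz.
by split=> //; rewrite addrC.
Qed.

Lemma slice_row i m n f : degree_one n f ->
  slice (coord i) (- m%:Z) f = mon 1 (row_base i m n) * homogenize i (row_poly i m n f).
Proof.
move=> f1; rewrite homogenize_poly mulr_sumr; apply: coefP => k.
rewrite coef_slice coef_sum /=.
have E (j : nat) : coef (mon 1 (row_base i m n) * mon (coef f (row_key i m n j)) (edge i *+ j)) k =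
    if row_key i m n j == k then coef f k else 0.
  rewrite monM mul1r coef_mon -/(row_key i m n j).
  by case: eqP => [->|].
under eq_bigr => j _ do rewrite E.
have [fk|fk] := eqVneq (coef f k) 0.
  by rewrite fk if_same big1 // => j _; rewrite if_same.
have [k1 kn] := f1 k fk; case: eqP => [km|km]; last first.
  rewrite big1 // => j _; case: eqP => // jk; case: km.
  by rewrite -jk; case: (coord_row_key i m n j).
pose j0 := `|(coord (nx i) k + n%:Z)%R|%N.
have := kn (nx i); have := kn (nx (nx i)); move: k1; rewrite (deg_nx i) km => k1 k2 k3.
have j0n : (j0 < n + n + m + 2)%N by rewrite /j0; lia.
have j0k : row_key i m n j0 = k.
  have [c0 c1 c2] := coord_row_key i m n j0; apply: expoP => a.
  by have [->|->|->] := nx_cases i a; rewrite ?c0 ?c1 ?c2 /j0; lia.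
rewrite (bigD1 (Ordinal j0n)) //= j0k eqxx big1 ?addr0 // => j jj0.
case: eqP => // jk; case/eqP: jj0; apply: val_inj => /=.
have [_ c1 _] := coord_row_key i m n j; move: c1; rewrite jk /j0 => ->.
by lia.
Qed.

Lemma row_divisible i m n f : degree_one n f ->
  Pdiv.CommonRing.rmodp (row_poly i m n f) (cubic_poly i ^+ m) = 0 ->
  exists h, slice (coord i) (- m%:Z) f = cubic al be i ^+ m * h.
Proof.
move=> f1 r0; rewrite (slice_row i m f1).
have mon_c : cubic_poly i ^+ m \is monic by apply: monic_exp; exact: monicXnaddC.
rewrite [row_poly _ _ _ _](Pdiv.RingMonic.rdivp_eq mon_c) r0 addr0.
set q := Pdiv.CommonRing.rdivp _ _.
rewrite homogenizeM homogenizeX cubicE.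
set M := mon (al i) _; pose M' := mon (al i)^-1 (- (unit_expo (nx (nx i)) *+ 3)).
have MM' : M * M' = 1 by rewrite monM mulrV // subrr mon1.
exists (M' ^+ m * mon 1 (row_base i m n) * homogenize i q).
exact: regroup.
Qed.

(** These coefficients vanish, for l < 3m, exactly when p_i^m divides the
    coefficient of x_i^{-m}; they are linear in [f] as the divisor is monic. *)
Definition obstruction i m n l f : R :=
  (Pdiv.CommonRing.rmodp (row_poly i m n f) (cubic_poly i ^+ m))`_l.

Lemma obstructionD i m n l f g :
  obstruction i m n l (f + g) = obstruction i m n l f + obstruction i m n l g.
Proof.
have mon_c : cubic_poly i ^+ m \is monic by apply: monic_exp; exact: monicXnaddC.
rewrite /obstruction -poly.coefD -Pdiv.RingMonic.rmodpD //; congr ((Pdiv.CommonRing.rmodp _ _)`_l).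
by apply/polyP => j; rewrite poly.coefD !coef_poly; case: ifP; rewrite ?addr0 // coefD.
Qed.

Lemma obstructionZ i m n l c k :
  obstruction i m n l (mon c k) = c * obstruction i m n l (mon 1 k).
Proof.
have mon_c : cubic_poly i ^+ m \is monic by apply: monic_exp; exact: monicXnaddC.
rewrite /obstruction -coefZ -Pdiv.RingMonic.rmodpZ //; congr ((Pdiv.CommonRing.rmodp _ _)`_l).
rewrite /row_poly !poly_def scaler_sumr; apply: eq_bigr => j _.
by rewrite !coef_mon scalerA mulr_natr.
Qed.

Lemma obstruction0 i m n l : obstruction i m n l 0 = 0.
Proof. by rewrite -(mon0 R 0) obstructionZ mul0r. Qed.

Lemma obstruction_divisible i m n f : degree_one n f ->
  (forall l, (l < 3 * m)%N -> obstruction i m n l f = 0) ->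
  exists h, slice (coord i) (- m%:Z) f = cubic al be i ^+ m * h.
Proof.
move=> f1 o0; apply: row_divisible f1 _; apply/polyP => l; rewrite poly.coef0.
have c0 : cubic_poly i ^+ m != 0 by rewrite monic_neq0 // monic_exp // monicXnaddC.
have [lm|ml] := ltnP l (3 * m); first exact: o0.
apply: nth_default; apply: leq_trans ml; rewrite -ltnS.
apply: leq_trans (Pdiv.CommonRing.ltn_rmodpN0 _ c0) _.
have := size_exp (cubic_poly i) m; rewrite size_XnaddC //= => <-.
exact: leqSpred.
Qed.

End Rows.

Section Count.

Lemma card_sigma_ord n (g : nat -> nat) :
  #|{: {r : 'I_n & 'I_(g r)}}| = (\sum_(r < n) g r)%N.
Proof.
rewrite card_tagged sumnE big_map big_enum /=.
by apply: eq_bigr => r _; rewrite card_ord.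
Qed.

Lemma triangular n : (2 * \sum_(r < n) r.+1 = n * n.+1)%N.
Proof. by elim: n => [|n IH]; rewrite ?big_ord0 // big_ord_recr /= mulnDr IH; lia. Qed.

End Count.

Section Existence.
Variables (R : idomainType) (al be : 'I_3 -> R) (N : nat).
Hypothesis al_unit : forall i, al i \is a GRing.unit.

(* The unknowns exceed the divisibility conditions by 3n + 3 in number. *)
Let n := ((3 * N + 2) * (3 * N + 2))%N.

(** The unknowns are the coefficients of a form of degree 3n + 1, divided by
    (x_0 x_1 x_2)^n. The equations are the divisibility conditions, and the
    vanishing of the coefficients at the exponents of degree 1 with all coordinates
    at least [- N], which are at most (3N+2)^2 in number. *)
Definition unknown : finType := {r : 'I_(3 * n + 2) & 'I_r.+1}.
Definition equation : finType :=
  ('I_3 * {m : 'I_n & 'I_(3 * m.+1)} + 'I_(3 * N + 2) * 'I_(3 * N + 2))%type.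

Lemma card_unknown : (#|equation| < #|unknown|)%N.
Proof.
rewrite /unknown /equation card_sum !card_prod !card_ord (card_sigma_ord _ S).
rewrite (card_sigma_ord _ (fun m => 3 * m.+1)%N) -big_distrr /= -/n.
have := triangular (3 * n + 2); have := triangular n.
set T := (\sum_(r < n) _)%N; set U := (\sum_(r < _) _)%N.
by move: T U n => T U x; nia.
Qed.

Definition next_0 : 'I_3 := nx ord0.
Definition prev_0 : 'I_3 := nx (nx ord0).

(** The exponents of degree 1 are determined by their first two coordinates. *)
Definition plane_expo (a b : int) : Z3 :=
  expo (fun i => if i == ord0 then a else if i == next_0 then b else 1 - a - b).

Definition unknown_key (x : unknown) : Z3 :=
  plane_expo ((tagged x : nat)%:Z - n%:Z) ((tag x)%:Z - (tagged x : nat)%:Z - n%:Z).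

Lemma coord_plane_expo a b : [/\ coord ord0 (plane_expo a b) = a, coord next_0 (plane_expo a b) = b
  & coord prev_0 (plane_expo a b) = 1 - a - b].
Proof. by rewrite !coord_expo. Qed.

Lemma deg_plane_expo a b : deg (plane_expo a b) = 1.
Proof. by have [E0 E1 E2] := coord_plane_expo a b; rewrite (deg_nx ord0) E0 E1 E2; lia. Qed.

Lemma unknown_key_inj : injective unknown_key.
Proof.
move=> [r s] [r' s'] E.
have [E0 E1 _] := coord_plane_expo ((s : nat)%:Z - n%:Z) ((r : nat)%:Z - (s : nat)%:Z - n%:Z).
have [E0' E1' _] := coord_plane_expo ((s' : nat)%:Z - n%:Z) ((r' : nat)%:Z - (s' : nat)%:Z - n%:Z).
move: E0 E1; rewrite -[plane_expo _ _]/(unknown_key (existT _ r s)) E /unknown_key /= E0' E1' => ss rr.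
have rE : r = r' by apply: val_inj => /=; lia.
by subst r'; congr existT; apply: val_inj => /=; lia.
Qed.

Lemma unknown_degree_one x i : - n%:Z <= coord i (unknown_key x).
Proof.
have [E0 E1 E2] := coord_plane_expo ((tagged x : nat)%:Z - n%:Z) ((tag x : nat)%:Z - (tagged x : nat)%:Z - n%:Z).
have := ltn_ord (tagged x); have := ltn_ord (tag x).
by have [->|->|->] := nx_cases ord0 i; rewrite ?E0 ?E1 ?E2; lia.
Qed.

Definition constraint (e : equation) (f : laurent R) : R :=
  match e with
  | inl (i, existT m l) => obstruction al be i m.+1 n l f
  | inr (a, b) => coef f (plane_expo (a%:Z - N%:Z) (b%:Z - N%:Z))
  end.

Lemma constraint_sum (v : unknown -> R) e :
  constraint e (\sum_x mon (v x) (unknown_key x)) =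
  \sum_x v x * constraint e (mon 1 (unknown_key x)).
Proof.
case: e => [[i [m l]]|[a b]] /=.
  rewrite (big_morph _ (obstructionD al be i m.+1 n l) (obstruction0 al be i m.+1 n l)).
  by apply: eq_bigr => x _; rewrite obstructionZ.
by rewrite coef_sum; apply: eq_bigr => x _; rewrite !coef_mon mulr_natr.
Qed.

(** A nonzero solution of the system has a coefficient that is not at an exponent
    with all coordinates at least [- N]. *)
Lemma unbounded_degree_one : exists f : laurent R, [/\ admissible al be f,
  forall k, coef f k != 0 -> deg k = 1 &
  exists k i, coef f k != 0 /\ coord i k < - N%:Z].
Proof.
have [v [[x vx] v0]] := more_unknowns (fun x e => constraint e (mon 1 (unknown_key x))) card_unknown.
pose f : laurent R := \sum_x mon (v x) (unknown_key x).
have f0 e : constraint e f = 0 by rewrite constraint_sum v0.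
have fE y : coef f (unknown_key y) = v y.
  rewrite coef_sum (bigD1 y) //= coef_mon eqxx big1 ?addr0 ?mulr1n // => z zy.
  by rewrite coef_mon (inj_eq unknown_key_inj) (negbTE zy).
have f1 : degree_one n f.
  move=> k fk; have [y /eqP->] : exists y, k == unknown_key y.
    apply/existsP; apply: contraNT fk; rewrite negb_exists => /forallP ny.
    rewrite coef_sum big1 // => y _; rewrite coef_mon.
    by have := ny y; rewrite eq_sym => /negbTE ->.
  by split; [exact: deg_plane_expo|exact: unknown_degree_one].
exists f; split=> [i m|k /f1[]//|].
  have [mn|nm] := leqP m n; last first.
    exists 0; rewrite mulr0; apply: coefP => k; rewrite coef_slice coef0 /=.
    case: eqP => // km; apply/eqP; apply: contraT => /f1[_ /(_ i)].
    by rewrite km; lia.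
  case: m mn => [|m] mn; first by exists (slice (coord i) (- 0%:Z) f); rewrite expr0 mul1r.
  apply: (obstruction_divisible al_unit f1) => l lm.
  exact: (f0 (inl (i, existT _ (Ordinal mn) (Ordinal lm)))).
exists (unknown_key x).
have [i xi] : exists i, coord i (unknown_key x) < - N%:Z.
  apply/existsP; apply: contraNT vx; rewrite negb_exists => /forallP xN.
  have [E0 E1 E2] := coord_plane_expo ((tagged x : nat)%:Z - n%:Z) ((tag x : nat)%:Z - (tagged x : nat)%:Z - n%:Z).
  have := xN ord0; have := xN next_0; have := xN prev_0; rewrite -!leNgt E0 E1 E2.
  set a := _ - n%:Z in E0 E1 E2 *; set b := _ - n%:Z in E0 E1 E2 * => x2 x1 x0.
  have aN : (`|(a + N%:Z)%R| < 3 * N + 2)%N by lia.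
  have bN : (`|(b + N%:Z)%R| < 3 * N + 2)%N by lia.
  have := f0 (inr (Ordinal aN, Ordinal bN)); rewrite /= -fE => fab.
  apply/eqP; rewrite -[RHS]fab; congr (coef f _); rewrite /unknown_key -/a -/b.
  by congr plane_expo; lia.
by exists i; rewrite fE.
Qed.

End Existence.

(** * The theorem *)

Section Slices.
Variable P : torsionFreeZmodType.
Local Notation ZP := (group_ring int P).
Local Notation F := (ambient P).
Local Notation evr := (ev (@of_ring P)).
Variable s : seed P.
Hypothesis rows : forall k, exists i, exch s k i != 0.

Lemma rows_neq0 k : exchange_poly s k != 0.
Proof. by have [i ki] := rows k; exact: exchange_poly_neq0 ki. Qed.

(** By [slices_divisible_ind], the element is a polynomial in a cluster variable
    and its partner over the Laurent ring in the other variables. *)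
Lemma upper_bound_of_slices g :
  (forall k, slices_divisible k (exchange_poly s k) g) -> upper_bound s (evr (cluster s) g).
Proof.
move=> gs; split=> [|k]; first exact: laurent_ring_ev.
have y0 := seed_neq0 s; have gk := gs k; clear gs; move: g gk.
apply: (slices_divisible_ind (@exchange_poly_homog _ s k)).
- by move=> g h Lg Lh; rewrite evD; exact: alg_gen_add.
- by rewrite ev0; exact: alg_gen0.
- move=> c e ek; rewrite ev_mon; apply: alg_gen_mul; first exact: alg_gen_ring.
  rewrite monevE; apply: big_ind; first exact: alg_gen1.
    by move=> *; exact: alg_gen_mul.
  move=> i _; have [->|ik] := eqVneq i k.
    rewrite -(gez0_abs ek) -exprnP (cluster_of_neighbour (rows_neq0 k)); apply: alg_genX.
    apply: alg_gen_mul; first exact: laurent_ring_ev.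
    by apply: alg_gen_in; exists k; right.
  have -> : cluster s i = neighbour s k i by rewrite /neighbour /exchanged (negbTE ik).
  exact: laurent_ring_varz.
move=> g Lg; rewrite evM //; apply: alg_gen_mul Lg.
rewrite evM // /var_inv ev_mon monevN // monev_unit rmorph1 mul1r.
by apply: alg_gen_in; exists k; left; rewrite /neighbour /exchanged eqxx.
Qed.

Lemma slices_of_upper_bound f : upper_bound s f -> exists2 g, f = evr (cluster s) g &
  forall k, slices_divisible k (exchange_poly s k) g.
Proof.
have y0 := seed_neq0 s; case=> fy fn; have [g fE] := laurent_ringP y0 fy.
exists g => // k n.
have nb0 := exchanged_neq0 k y0 (@seed_inj _ s) (rows_neq0 k).
have [g' g'E] := laurent_ringP nb0 (fn k).
apply: (slice_exchanged y0 (@seed_inj _ s) (rows_neq0 k) (@exchange_poly_homog _ s k) n (g' := g')).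
by rewrite -fE.
Qed.

End Slices.

Section Bounded.
Variables (R : idomainType) (al be : 'I_3 -> R).
Hypotheses (al0 : forall i, al i != 0) (be0 : forall i, be i != 0).
Hypothesis nontorsion : forall n, (0 < n)%N -> \prod_i al i ^+ n != \prod_i be i ^+ n.

(** No negative degrees, only constants in degree 0, and poles of order at most [N]
    in degree 1: a condition closed under sums and products. *)
Definition bounded N (g : laurent R) := forall k, coef g k != 0 ->
  [/\ 0 <= deg k, deg k = 0 -> k = 0 & deg k = 1 -> forall i, - N%:Z <= coord i k].

Lemma admissible_bounded g : admissible al be g -> exists N, bounded N g.
Proof.
move=> ga; have [N gN] := coord_bound g; exists N => k gk.
have k0 : deg k <= 0 -> k = 0.
  move=> dk; apply: (nonpositive_degree al0 be0 nontorsion (admissible_slice (deg k) ga) _ dk).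
    by move=> l; rewrite coef_slice /=; have [->|_] := eqVneq (deg l) (deg k); rewrite ?eqxx.
  by rewrite coef_slice /= eqxx.
split=> [|dk|_ i]; last 2 first.
- by apply: k0; rewrite dk.
- by have := gN k i; rewrite supp_neq0 => /(_ gk); lia.
rewrite leNgt; apply/negP => dk; have kz := k0 (ltW dk).
by move: dk; rewrite kz raddf0 ltxx.
Qed.

Lemma bounded_leq N M g : (N <= M)%N -> bounded N g -> bounded M g.
Proof.
move=> NM gN k /gN[d0 d1 d2]; split=> // /d2 kN i.
by apply: le_trans (kN i); lia.
Qed.

Lemma boundedD N g h : bounded N g -> bounded N h -> bounded N (g + h).
Proof.
move=> gN hN k; rewrite coefD; have [->|/gN//] := eqVneq (coef g k) 0.
by rewrite add0r; exact: hN.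
Qed.

(** A term of degree 1 in a product comes from a term of degree 1 in one factor and
    a constant in the other. *)
Lemma boundedM N g h : bounded N g -> bounded N h -> bounded N (g * h).
Proof.
move=> gN hN _ /coefM_neq0[k [l [-> /gN[k0 k1 k2] /hN[l0 l1 l2]]]].
rewrite raddfD /=; split=> [|kl|kl]; first by lia.
  have kz : deg k = 0 by lia.
  have lz : deg l = 0 by lia.
  by rewrite (k1 kz) (l1 lz) addr0.
have [kz|kz] := eqVneq (deg k) 0.
  by rewrite (k1 kz) add0r; apply: l2; lia.
have lz : deg l = 0 by lia.
by rewrite (l1 lz) addr0; apply: k2; lia.
Qed.

Lemma bounded_const N c : bounded N (mon c 0).
Proof.
move=> k; rewrite coef_mon; have [<- _|_] := eqVneq 0 k; last by rewrite mulr0n eqxx.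
by rewrite raddf0; split.
Qed.

End Bounded.

Section Main.
Variables (P : torsionFreeZmodType) (ap am : 'I_3 -> P).
Hypothesis nontorsion : forall n : nat, (0 < n)%N ->
  \sum_(i < 3) ap i *+ n <> \sum_(i < 3) am i *+ n.
Local Notation ZP := (group_ring int P).
Local Notation evr := (ev (@of_ring P) (@xvar P)).

Let s := initial_seed ap am exch3 exch3_skew.
Let al i : ZP := grp (ap i).
Let be i : ZP := grp (am i).

Lemma grp_inj : injective (@grp P).
Proof.
move=> p q pq; have : coef (mon (1 : int) p) p = coef (mon (1 : int) q) p by rewrite -[mon 1 p]/(grp p) pq.
by rewrite !coef_mon eqxx; case: eqP => // ->.
Qed.

Lemma grp_prod (a : 'I_3 -> P) n : \prod_i grp (a i) ^+ n = grp (\sum_i a i *+ n).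
Proof.
rewrite (big_morph (@grp P) (@grpD P) (@grp0 P)); apply: eq_bigr => i _.
by rewrite grpMn.
Qed.

Lemma prod_nontorsion n : (0 < n)%N -> \prod_i al i ^+ n != \prod_i be i ^+ n.
Proof. by move=> /nontorsion np; rewrite !grp_prod; apply/eqP => /grp_inj. Qed.

Lemma exchange_poly_exch3 k : exchange_poly s k = cubic al be k.
Proof.
rewrite /exchange_poly /cubic.
have -> : pos_expo (exch s) k = unit_expo (nx k) *+ 3.
  apply: expoP => i; rewrite coordMn coord_unit coord_expo /= mxE.
  by move: i k => [[|[|[|//]]] i3] [[|[|[|//]]] j3].
suff -> : neg_expo (exch s) k = unit_expo (nx (nx k)) *+ 3 by [].
apply: expoP => i; rewrite coordMn coord_unit coord_expo /= mxE.
by move: i k => [[|[|[|//]]] i3] [[|[|[|//]]] j3].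
Qed.

Lemma not_finitely_generated : ~ finitely_generated (upper_cluster_algebra s).
Proof.
move=> [gens U_gens].
have ms : markov (exch s) := markov_exch3.
have rows k : exists i, exch s k i != 0 := markov_row_neq0 k ms.
have mut k : exists t, mutation k s t.
  by have [i ki] := rows k; apply: mutation_exists ki (mutate_exch3_skew k).
have al0 i : al i != 0 := grp_neq0 _.
have be0 i : be i != 0 := grp_neq0 _.
have gen_bounded f : f \in gens -> exists N, exists2 g, f = evr g & bounded N g.
  move=> fg; have fU : upper_cluster_algebra s f by apply/U_gens; exact: alg_gen_in.
  have [g fE gs] := slices_of_upper_bound rows (upper_cluster_bound mut fU).
  have ga : admissible al be g by move=> k; rewrite -exchange_poly_exch3; exact: gs.
  by have [N gN] := admissible_bounded al0 be0 prod_nontorsion ga; exists N, g.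
have [N gensN] : exists N, forall f, f \in gens -> exists2 g, f = evr g & bounded N g.
  elim: {U_gens} gens gen_bounded => [|f r IH] gb; first by exists 0%N.
  have [N [g fE gN]] := gb f (mem_head _ _).
  have [|M rM] := IH; first by move=> h hr; apply: gb; rewrite inE hr orbT.
  exists (N + M)%N => h; rewrite inE => /predU1P[->|/rM[g' hE g'M]].
    by exists g; [exact: fE|apply: bounded_leq gN; exact: leq_addr].
  by exists g'; [exact: hE|apply: bounded_leq g'M; exact: leq_addl].
have U_bounded f : upper_cluster_algebra s f -> exists2 g, f = evr g & bounded N g.
  move=> /U_gens; elim=> {f} [a|f /gensN//|f f' _ [g -> gN] _ [g' -> g'N]|f f' _ [g -> gN] _ [g' -> g'N]].
  - by exists (mon a 0); [rewrite ev_mon monev0 mulr1|exact: bounded_const].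
  - by exists (g + g'); [rewrite evD|exact: boundedD].
  by exists (g * g'); [rewrite evM //; exact: (seed_neq0 s)|exact: boundedM].
have al_unit i : al i \is a GRing.unit := grp_unit _.
have [f [fa f1 [k [i [fk ki]]]]] := unbounded_degree_one be N al_unit.
have : upper_cluster_algebra s (evr f).
  apply: upper_bound_sub ms _; apply: (upper_bound_of_slices rows) => l.
  by rewrite exchange_poly_exch3; exact: fa.
move=> /U_bounded[g fg gN].
have fgE : f = g.
  apply/eqP; rewrite -subr_eq0; apply/eqP/(@seed_inj _ s).
  by rewrite evB; apply/eqP; rewrite subr_eq0; apply/eqP.
rewrite fgE in fk f1; have [_ _ /(_ (f1 k fk))/(_ i)] := gN k fk.
by rewrite leNgt ki.
Qed.

End Main.

Theorem mainTheorem2 :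
  (forall (P : torsionFreeZmodType) (ap am : 'I_3 -> P),
     (forall n : nat, (0 < n)%N ->
        \sum_(i < 3) ap i *+ n <> \sum_(i < 3) am i *+ n) ->
     ~ finitely_generated
         (upper_cluster_algebra (initial_seed ap am exch3 exch3_skew)))
  /\ (exists (P : torsionFreeZmodType) (s : seed P),
        ~ finitely_generated (upper_cluster_algebra s)).
Proof.
split=> [P ap am|]; first exact: not_finitely_generated.
exists (int : torsionFreeZmodType), (@initial_seed int (fun=> 1%Z) (fun=> 0%Z) exch3 exch3_skew).
apply: not_finitely_generated => n n0.
by rewrite !big_ord_recr !big_ord0 /= !mul0rn; lia.
Qed.
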